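(* For any super-reflexive Banach space $\mathbb{E}$ the pairs $(\mathrm{SL}_3(\mathbb{Z}),\mathrm{UT}_3(\mathbb{Z}))$ and $(\mathrm{SL}_3(\mathbb{Z}),\mathrm{LT}_3(\mathbb{Z}))$ both have relative property $(T_{\mathbb{E}})$.
   Context: $\mathrm{UT}_3(\mathbb{Z})$ and $\mathrm{LT}_3(\mathbb{Z})$ denote the subgroups of $\mathrm{SL}_3(\mathbb{Z})$ of upper-triangular, respectively lower-triangular, matrices with all diagonal entries equal to $1$. $\mathrm{SL}_3(\mathbb{Z})$ is a discrete group. A Banach space $\mathbb{E}$ is uniformly convex if there is a function $\delta:(0,2]\to(0,1]$ such that for every $0<\varepsilon\le 2$ and all unit vectors $\xi,\eta\in\mathbb{E}$ with $\|\xi-\eta\|\ge\varepsilon$ one has $\|\frac{\xi+\eta}{2}\|\le 1-\delta(\varepsilon)$. A Banach space is super-reflexive if and only if it admits an equivalent uniformly convex norm (this can be taken as the definition). $O(\mathbb{E})$ is the group of invertible linear isometries of $\mathbb{E}$ with the strong operator topology. For a topological group $G$, a subgroup $H<G$ and a Banach space $\mathbb{E}$, the pair $(G,H)$ has relative (Banach) property $(T_{\mathbb{E}})$ if for every continuous linear isometric representation $\pi:G\to O(\mathbb{E})$ and every constant $\gamma>0$ there are a compact set $K\subseteq G$ and a constant $\varepsilon>0$ such that for every unit vector $\xi\in\mathbb{E}$, if $\sup_{g\in K}\|\pi(g)\xi-\xi\|<\varepsilon$, then there exists $\eta\in\mathbb{E}^{\pi(H)}$ (the subspace of $\pi(H)$-fixed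 vectors) such that $\|\xi-\eta\|<\gamma$. *)

(* Defs.v *)
From HB Require Import structures.
From mathcomp Require Import all_boot all_order all_algebra.
From mathcomp Require Import mathcomp_extra boolp classical_sets functions reals.
From mathcomp Require Import topology normedtype.
From mathcomp Require Export complex.

Set Implicit Arguments.
Unset Strict Implicit.
Unset Printing Implicit Defensive.

Import Order.TTheory GRing.Theory Num.Theory.
Import numFieldNormedType.Exports.

Local Open Scope classical_set_scope.
Local Open Scope ring_scope.

HB.mixin Record isTopologicalGroup G & Group G & Topological G := {
  mulg_continuous : continuous (fun x : G * G => (x.1 * x.2)%g);
  invg_continuous : continuous (fun x : G => (x^-1)%g)
}.

#[short(type="topologicalGroupType")]
HB.structure Definition TopologicalGroup :=
  {G of Group G & Topological G & isTopologicalGroup G}.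

Section SuperReflexive.
Context {K : numFieldType}.

(* Nonnegativity follows from the triangle inequality and homogeneity. *)
Record is_norm (V : lmodType K) (N : V -> K) : Prop := IsNorm {
  is_norm_triangle : forall x y, N (x + y) <= N x + N y;
  is_norm_homogeneous : forall a x, N (a *: x) = `|a| * N x;
  is_norm_eq0 : forall x, N x = 0 -> x = 0
}.

Definition equivalent_norms (V : lmodType K) (N M : V -> K) : Prop :=
  exists c C : K, [/\ 0 < c, 0 < C &
    forall x, c * N x <= M x /\ M x <= C * N x].

Definition uniformly_convex (V : lmodType K) (N : V -> K) : Prop :=
  exists delta : K -> K,
    (forall eps, 0 < eps <= 2 -> 0 < delta eps <= 1) /\
    (forall eps, 0 < eps <= 2 -> forall x y : V,
      N x = 1 -> N y = 1 -> eps <= N (x - y) ->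
      N (2^-1 *: (x + y)) <= 1 - delta eps).

Definition super_reflexive (E : completeNormedModType K) : Prop :=
  exists N : E -> K,
    [/\ is_norm N, equivalent_norms (fun x : E => `|x|) N &
        uniformly_convex N].

End SuperReflexive.

(* The group O(E); injectivity follows from isometry. *)
Section LinearIsometries.
Context {K : numFieldType} (E : normedModType K).

Record linear_isometry := LinearIsometry {
  isometry_fun :> E -> E;
  isometry_linear : linear isometry_fun;
  isometry_norm : forall x, `|isometry_fun x| = `|x|;
  isometry_surj : forall y, exists x, isometry_fun x = y
}.

HB.instance Definition _ := gen_eqMixin linear_isometry.
HB.instance Definition _ := gen_choiceMixin linear_isometry.

Implicit Types u v w : linear_isometry.

Lemma isometry_ext u v : u =1 v -> u = v.
Proof.
case: u v => [f fl fn fs] [g gl gn gs] /= /funext fg.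
by subst g; congr LinearIsometry; exact: Prop_irrelevance.
Qed.

Lemma isometry_inj u : injective u.
Proof.
move=> x y uxy; apply/subr0_eq/normr0_eq0.
rewrite -(isometry_norm u) -[x - y]addrC -scaleN1r isometry_linear.
by rewrite uxy scaleN1r addNr normr0.
Qed.

Definition isometry_one : linear_isometry.
Proof. by exists (fun x => x) => // y; exists y. Defined.

Definition isometry_mul u v : linear_isometry.
Proof.
exists (u \o v) => [a x y|x|y] /=.
- by rewrite !isometry_linear.
- by rewrite !isometry_norm.
- have [z <-] := isometry_surj u y; have [x <-] := isometry_surj v z.
  by exists x.
Defined.

Definition isometry_inv_fun u (y : E) : E := sval (cid (isometry_surj u y)).

Lemma isometry_invK u : cancel (isometry_inv_fun u) u.
Proof. by move=> y; rewrite /isometry_inv_fun; case: cid. Qed.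

Definition isometry_inv u : linear_isometry.
Proof.
exists (isometry_inv_fun u) => [a x y|x|y].
- by apply: (@isometry_inj u); rewrite isometry_linear !isometry_invK.
- by rewrite -(isometry_norm u) isometry_invK.
- by exists (u y); apply: (@isometry_inj u); rewrite isometry_invK.
Defined.

Lemma isometry_mulA : associative isometry_mul.
Proof. by move=> u v w; apply: isometry_ext. Qed.
Lemma isometry_mul1 : left_id isometry_one isometry_mul.
Proof. by move=> u; apply: isometry_ext. Qed.
Lemma isometry_mulr1 : right_id isometry_one isometry_mul.
Proof. by move=> u; apply: isometry_ext. Qed.
Lemma isometry_mulV : left_inverse isometry_one isometry_inv isometry_mul.
Proof.
move=> u; apply: isometry_ext => x /=.
by apply: (@isometry_inj u); rewrite isometry_invK.
Qed.
Lemma isometry_mulrV : right_inverse isometry_one isometry_inv isometry_mul.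
Proof. by move=> u; apply: isometry_ext => x /=; rewrite isometry_invK. Qed.

HB.instance Definition _ := isGroup.Build linear_isometry
  isometry_mulA isometry_mul1 isometry_mulr1 isometry_mulV isometry_mulrV.

(* The strong operator topology: pointwise convergence in norm. *)
Definition isometry_ptws (u : linear_isometry) : {ptws E -> E} := u.

HB.instance Definition _ :=
  Topological.copy linear_isometry (initial_topology isometry_ptws).

End LinearIsometries.

Section RelativePropertyT.
Context {K : numFieldType} (E : completeNormedModType K).
Context (G : topologicalGroupType).

Definition fixed_vectors (pi : G -> linear_isometry E) (H : {pred G}) : set E :=
  [set x | forall h, h \in H -> pi h x = x].

(* [supremum 0] is [sup] when [K] is a [realType]; for complex scalars it is *)
(* the supremum, computed in the partial order of [R[i]], of a bounded set   *)
(* of nonnegative reals.                                                     *)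
Definition relative_property_T (H : groupClosed G) : Prop :=
  forall pi : {multiplicative G -> linear_isometry E}, continuous pi ->
  forall gamma : K, 0 < gamma ->
  exists (Q : set G) (eps : K), [/\ compact Q, 0 < eps &
    forall xi : E, `|xi| = 1 ->
      supremum 0 [set `|pi g xi - xi| | g in Q] < eps ->
      exists2 eta : E, fixed_vectors pi H eta & `|xi - eta| < gamma].

End RelativePropertyT.

Arguments relative_property_T {K} E G H.

Record SL3Z := MkSL3Z { SL3Z_mx :> 'M[int]_3; _ : \det SL3Z_mx == 1 }.

HB.instance Definition _ := [isSub for SL3Z_mx].
HB.instance Definition _ := [Choice of SL3Z by <:].

Section SL3ZGroup.
Implicit Types g h k : SL3Z.

Lemma SL3Z_det g : \det g = 1.
Proof. by apply/eqP; case: g. Qed.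

Lemma SL3Z_det1 : \det (1%:M : 'M[int]_3) == 1.
Proof. by rewrite det1. Qed.
Definition SL3Z_one := MkSL3Z SL3Z_det1.

Lemma SL3Z_detM g h : \det (g *m h) == 1.
Proof. by rewrite det_mulmx !SL3Z_det mulr1. Qed.
Definition SL3Z_mul g h := MkSL3Z (SL3Z_detM g h).

Lemma SL3Z_detV g : \det (invmx g) == 1.
Proof. by rewrite det_inv SL3Z_det invr1. Qed.
Definition SL3Z_inv g := MkSL3Z (SL3Z_detV g).

Lemma SL3Z_unitmx g : (g : 'M_3) \in unitmx.
Proof. by rewrite unitmxE SL3Z_det unitr1. Qed.

Lemma SL3Z_mulA : associative SL3Z_mul.
Proof. by move=> g h k; apply/val_inj/mulmxA. Qed.
Lemma SL3Z_mul1 : left_id SL3Z_one SL3Z_mul.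
Proof. by move=> g; apply/val_inj/mul1mx. Qed.
Lemma SL3Z_mulr1 : right_id SL3Z_one SL3Z_mul.
Proof. by move=> g; apply/val_inj/mulmx1. Qed.
Lemma SL3Z_mulV : left_inverse SL3Z_one SL3Z_inv SL3Z_mul.
Proof. by move=> g; apply/val_inj/mulVmx/SL3Z_unitmx. Qed.
Lemma SL3Z_mulrV : right_inverse SL3Z_one SL3Z_inv SL3Z_mul.
Proof. by move=> g; apply/val_inj/mulmxV/SL3Z_unitmx. Qed.

HB.instance Definition _ := isGroup.Build SL3Z
  SL3Z_mulA SL3Z_mul1 SL3Z_mulr1 SL3Z_mulV SL3Z_mulrV.

End SL3ZGroup.

HB.instance Definition _ :=
  DiscreteTopology.copy SL3Z (discrete_topology SL3Z).

Lemma SL3Z_mul_continuous :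
  continuous (fun x : SL3Z * SL3Z => (x.1 * x.2)%g).
Proof.
move=> [g h] /=; apply/discrete_cvg.
exists ([set g], [set h]); first by split; exact: discrete_set1.
by case=> g' h' /= [-> ->].
Qed.

Lemma SL3Z_inv_continuous : continuous (fun x : SL3Z => (x^-1)%g).
Proof.
move=> g; apply/discrete_cvg.
by apply: (filterS _ (discrete_set1 g)) => h /= ->.
Qed.

HB.instance Definition _ := isTopologicalGroup.Build SL3Z
  SL3Z_mul_continuous SL3Z_inv_continuous.

Section Unitriangular.
Implicit Types A B : 'M[int]_3.

(* [is_trig_mx] is lower triangularity. *)
Definition lower_unitriangular A : bool :=
  is_trig_mx A && [forall i, A i i == 1].

Lemma lower_unitriangularP A :
  reflect ((forall i j : 'I_3, (i < j)%N -> A i j = 0) /\ forall i, A i i = 1)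
    (lower_unitriangular A).
Proof.
apply: (iffP andP) => -[].
  by move=> /is_trig_mxP At /forallP Ad; split=> // i; exact/eqP.
by move=> At Ad; split; [exact/is_trig_mxP | apply/forallP => i; rewrite Ad].
Qed.

Lemma lower_unitriangular1 : lower_unitriangular 1%:M.
Proof.
apply/lower_unitriangularP; split=> [i j ij|i]; rewrite mxE ?eqxx//.
by rewrite -val_eqE /= ltn_eqF.
Qed.

Lemma lower_unitriangularM A B :
  lower_unitriangular A -> lower_unitriangular B -> lower_unitriangular (A *m B).
Proof.
move=> /lower_unitriangularP[At Ad] /lower_unitriangularP[Bt Bd].
apply/lower_unitriangularP; split=> [i j ij|i]; rewrite mxE.
  rewrite big1// => k _; have [ik|ki] := ltnP i k; first by rewrite At ?mul0r.
  by rewrite Bt ?mulr0// (leq_ltn_trans ki).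
rewrite (bigD1 i)//= Ad Bd mulr1 big1 ?addr0// => k.
rewrite -val_eqE neq_ltn => /orP[] ki; last by rewrite At ?mul0r.
by rewrite Bt ?mulr0.
Qed.

Lemma lower_unitriangularV A :
  lower_unitriangular A -> lower_unitriangular (invmx A).
Proof.
move=> LA; have /lower_unitriangularP[At Ad] := LA.
have uA : A \in unitmx.
  have /andP[trA _] := LA.
  by rewrite unitmxE det_trig// big1 ?unitr1.
set B := invmx A; have AB i j : \sum_k A i k * B k j = (i == j)%:R.
  by have := congr1 (fun M : 'M_3 => M i j) (mulmxV uA); rewrite !mxE.
have Bt (i j : 'I_3) : (i <= j)%N -> B i j = (i == j)%:R.
  move: {2}(i : nat) (leqnn i) j => n; elim: n i => [|n IH] i lein j leij.
    rewrite -AB (bigD1 i)//= Ad mul1r big1 ?addr0// => k ki.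
    rewrite At ?mul0r// (leq_ltn_trans lein)// lt0n; apply: contraNneq ki => k0.
    by rewrite -val_eqE /= k0 eq_sym -leqn0.
  rewrite -AB (bigD1 i)//= Ad mul1r big1 ?addr0// => k.
  rewrite -val_eqE neq_ltn => /orP[] ki; last by rewrite At ?mul0r.
  rewrite (IH k (leq_trans ki lein) j (leq_trans (ltnW ki) leij)).
  by rewrite -val_eqE ltn_eqF ?mulr0// (leq_trans ki).
apply/lower_unitriangularP; split=> [i j ij|i]; rewrite Bt ?eqxx ?(ltnW ij)//.
by rewrite -val_eqE ltn_eqF.
Qed.

End Unitriangular.

Definition LT3Z : {pred SL3Z} := [pred g : SL3Z | lower_unitriangular g].
Definition UT3Z : {pred SL3Z} := [pred g : SL3Z | lower_unitriangular g^T].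

Lemma LT3Z_mul_closed : mulg_closed LT3Z.
Proof. by move=> g h; exact: lower_unitriangularM. Qed.
Lemma LT3Z_one : (1%g : SL3Z) \in LT3Z.
Proof. exact: lower_unitriangular1. Qed.
Lemma LT3Z_inv_closed : invg_closed LT3Z.
Proof. by move=> g; exact: lower_unitriangularV. Qed.

HB.instance Definition _ := isMulClosed.Build SL3Z LT3Z LT3Z_mul_closed.
HB.instance Definition _ := isMul1Closed.Build SL3Z LT3Z LT3Z_one.
HB.instance Definition _ := isInvClosed.Build SL3Z LT3Z LT3Z_inv_closed.

Lemma UT3Z_mul_closed : mulg_closed UT3Z.
Proof.
move=> g h gU hU; rewrite inE /= trmx_mul.
exact: lower_unitriangularM hU gU.
Qed.
Lemma UT3Z_one : (1%g : SL3Z) \in UT3Z.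
Proof. by rewrite inE /= trmx1; exact: lower_unitriangular1. Qed.
Lemma UT3Z_inv_closed : invg_closed UT3Z.
Proof. by move=> g gU; rewrite inE /= trmx_inv; exact: lower_unitriangularV. Qed.

HB.instance Definition _ := isMulClosed.Build SL3Z UT3Z UT3Z_mul_closed.
HB.instance Definition _ := isMul1Closed.Build SL3Z UT3Z UT3Z_one.
HB.instance Definition _ := isInvClosed.Build SL3Z UT3Z UT3Z_inv_closed.

(* Main.v *)
Require Import Defs.
From HB Require Import structures.
From mathcomp Require Import all_boot all_order all_algebra.
From mathcomp Require Import zify ring lra.
From mathcomp Require Import boolp classical_sets cardinality reals.
From mathcomp Require Import topology normedtype sequences.

Set Implicit Arguments.
Unset Strict Implicit.
Unset Printing Implicit Defensive.

Import Order.TTheory GRing.Theory Num.Theory.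
Import numFieldNormedType.Exports.

Local Open Scope ring_scope.

(** Let [x], [y], [z] be isometries generating a Heisenberg group with centre
    [z], and write [X_a], [Y_b], [Z_m] for the averages over the first [2 ^ a],
    [2 ^ b], [2 ^ m] powers. The engine of the proof is lemma [gain]: for a
    uniformly convex norm, [X_a Y_b Z_m] is almost independent of [m] as long as
    [m] stays away from [0] and from [a + b]. Two successive values differ by
    half of [X_a Y_b Z_m (1 - c)] with [c = z ^ (2 ^ m)], and [c] is the
    commutator of [x ^ p] and [y ^ q] whenever [p * q = 2 ^ m]. If averaging
    over [x ^ p] and [y ^ q] does not shrink a vector [v = u - c u], uniform
    convexity forces both to almost fix [v]. Hence [c] almost fixes [v], so that
    [u - c (c u) = v + c v] is almost [2 v]: the vector attached to the next
    scale of [z] is larger than [v] by a definite factor. In both cases a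
    suitably weighted bound over the scales of [z] improves by a constant
    factor ([commutator_contraction], [gain_step]). On scales of order [K ^ 2]
    there is room for [K] pairs [(p, q)] so widely spaced that the remaining
    commutators are negligible, whence an error of order [(1 - delta) ^ K].

    The six root subgroups of [SL_3(Z)] form a hexagon in which every root is
    the centre of the Heisenberg group generated by its two neighbours. In a
    product of six averages, one for each root, the scale of a letter standing
    between its two neighbours can therefore be changed at small cost
    ([word_rescale]), and a triple of neighbours can be reversed when its middle
    scale dominates ([word_swap]). Thirteen such moves lead from the product
    [T_K] at stage [K] to the one at stage [K + 1] ([hexagon_word_grow]). The
    costs are summable, so [T_K] converges in operator norm. Its limit takes
    values in the vectors fixed by the first root subgroup, and, after reversal
    of the first triple, by the third one; these two generate a unitriangular
    group. Finally [T_K] is an average over a finite set, so it hardly moves a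
    vector that is almost invariant under the six generators, and the limit is a
    fixed vector close to it ([fixed_vector_near]).

    A super-reflexive space carries an equivalent uniformly convex norm that is
    invariant under the representation, namely the supremum of a uniformly
    convex norm over orbits ([orbit_norm]). Complex spaces are treated by
    restriction of scalars. *)

(** * Linear maps and dyadic averages *)

Section LinearMaps.
Context {R : pzRingType} {V W : lmodType R}.
Implicit Types (f : V -> W) (u v : V).

Lemma linear_mapD f u v : linear f -> f (u + v) = f u + f v.
Proof. by move=> lf; have := lf 1 u v; rewrite !scale1r. Qed.

Lemma linear_map0 f : linear f -> f 0 = 0.
Proof.
by move=> lf; apply: (@addrI _ (f 0)); rewrite -linear_mapD// !addr0.
Qed.

Lemma linear_mapZ f a u : linear f -> f (a *: u) = a *: f u.
Proof. by move=> lf; have := lf a u 0; rewrite linear_map0// !addr0. Qed.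

Lemma linear_mapB f u v : linear f -> f (u - v) = f u - f v.
Proof. by move=> lf; rewrite linear_mapD// -scaleN1r linear_mapZ// scaleN1r. Qed.

End LinearMaps.

Section Norms.
Context {K : numFieldType} {V : lmodType K} {N : V -> K} (normN : is_norm N).
Implicit Types (u v w : V).

Lemma norm_opp u : N (- u) = N u.
Proof. by rewrite -scaleN1r (is_norm_homogeneous normN) normrN1 mul1r. Qed.

Lemma norm_sub u v : N (u - v) = N (v - u).
Proof. by rewrite -norm_opp opprB. Qed.

Lemma norm_zero : N 0 = 0.
Proof. by rewrite -(scale0r 0) (is_norm_homogeneous normN) normr0 mul0r. Qed.

Lemma norm_ge0 u : 0 <= N u.
Proof.
have := is_norm_triangle normN u (- u).
by rewrite subrr norm_zero norm_opp -mulr2n pmulrn_lge0.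
Qed.

End Norms.

Section Contractions.
Context {R : realType} {V : lmodType R} (N : V -> R) (normN : is_norm N).
Implicit Types (f g h S T : V -> V) (u v w : V).

Lemma norm_leB u v : N (u - v) <= N u + N v.
Proof. by rewrite -(norm_opp normN v) (is_norm_triangle normN). Qed.

Lemma norm_dist_triangle v u w : N (u - w) <= N (u - v) + N (v - w).
Proof. by rewrite -[u - w](subrKA v) (is_norm_triangle normN). Qed.

Lemma norm_half u : N (2^-1 *: u) = N u / 2.
Proof.
rewrite (is_norm_homogeneous normN) ger0_norm ?invr_ge0// mulrC //.
Qed.

Definition isometric_map f := linear f /\ forall v, N (f v) = N v.

Definition nonexpansive f := linear f /\ forall v, N (f v) <= N v.

Definition commuting f g := forall v, f (g v) = g (f v).

Lemma isometric_nonexpansive f : isometric_map f -> nonexpansive f.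
Proof. by case=> lf nf; split=> // v; rewrite nf. Qed.

Lemma nonexpansive_comp f g :
  nonexpansive f -> nonexpansive g -> nonexpansive (f \o g).
Proof.
move=> [lf nf] [lg ng]; split=> [a u v|v] /=; first by rewrite lg lf.
exact: le_trans (nf _) (ng _).
Qed.

Lemma isometric_iter f n : isometric_map f -> isometric_map (iter n f).
Proof.
move=> [lf nf]; elim: n => [|n [ln nn]]; first by split.
by split=> [a u v|v] /=; rewrite ?ln ?lf// nf nn.
Qed.

Lemma commuting_sym f g : commuting f g -> commuting g f.
Proof. by move=> fg v. Qed.

Lemma commuting_iter f g n : commuting f g -> commuting f (iter n g).
Proof. by move=> fg v; elim: n => //= n IH; rewrite fg IH. Qed.

Definition midway g v := 2^-1 *: (v + g v).

Lemma midway_nonexpansive g : nonexpansive g -> nonexpansive (midway g).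
Proof.
move=> [lg ng]; split=> [a u v|v]; rewrite /midway.
  by rewrite lg !scalerDr !scalerA addrACA mulrC.
rewrite norm_half ler_pdivrMr// mulr_natr mulr2n.
by rewrite (le_trans (is_norm_triangle normN _ _))// lerD2l.
Qed.

Lemma commuting_midway f g : linear f -> commuting f g -> commuting f (midway g).
Proof. by move=> lf fg v; rewrite /midway linear_mapZ// linear_mapD// fg. Qed.

(** The average of the first [2 ^ e] powers of [g]. In the product form uniform
    convexity can be applied once at every dyadic scale. *)
Fixpoint average g e v :=
  if e is e'.+1 then midway (iter (2 ^ e') g) (average g e' v) else v.

Lemma average_add g a l v :
  average g (a + l) v = average (iter (2 ^ a) g) l (average g a v).
Proof.
elim: l => [|l IH]; first by rewrite addn0.
by rewrite addnS /= IH expnD mulnC /midway; congr (_ *: (_ + _)); exact: iterM.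
Qed.

Lemma commuting_average f g e :
  linear f -> commuting f g -> commuting f (average g e).
Proof.
move=> lf fg v; elim: e => //= e IH.
by rewrite (commuting_midway lf (commuting_iter _ fg)) IH.
Qed.

Lemma commuting_iter_average f g p q e : linear f -> commuting f g ->
  commuting (iter p f) (average (iter q g) e).
Proof.
move=> lf fg; apply/commuting_sym/commuting_iter/commuting_sym.
exact/commuting_average/commuting_iter.
Qed.

Lemma average_nonexpansive g e : isometric_map g -> nonexpansive (average g e).
Proof.
move=> ig; elim: e => [|e IH]; first by split.
apply: (@nonexpansive_comp (midway (iter (2 ^ e) g)) _ _ IH).
exact/midway_nonexpansive/isometric_nonexpansive/isometric_iter.
Qed.

Lemma commuting_averages f g p q d e :
  isometric_map f -> isometric_map g -> commuting f g ->
  commuting (average (iter p f) d) (average (iter q g) e).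
Proof.
move=> isf isg fg; have [la _] := average_nonexpansive d (isometric_iter p isf).
apply: (commuting_average _ la); apply/commuting_iter/commuting_sym.
by apply: (commuting_average _ isg.1); apply/commuting_iter/commuting_sym.
Qed.

(** Any dyadic scale can be made the innermost factor, since the powers of one
    map commute. *)
Lemma average_split g e j : isometric_map g -> (j < e)%N ->
  exists2 S, nonexpansive S &
    forall v, average g e v = S (midway (iter (2 ^ j) g) v).
Proof.
move=> ig je.
have ci n := isometric_nonexpansive (isometric_iter n ig).
exists (average (iter (2 ^ j.+1) g) (e - j.+1) \o average g j).
  apply: nonexpansive_comp; apply: average_nonexpansive => //.
  exact: isometric_iter.
move=> v; rewrite -{1}(subnKC je) average_add /=; congr average.
have [lh _] := midway_nonexpansive (ci (2 ^ j)%N).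
apply: (commuting_average _ lh) => w; apply/commuting_sym.
by apply: (commuting_midway ig.1); exact: (commuting_iter _ (fun=> erefl)).
Qed.

Lemma isometric_iter_displacement g n v : isometric_map g ->
  N (iter n g v - v) <= n%:R * N (g v - v).
Proof.
move=> ig; elim: n => [|n IH]; first by rewrite subrr (norm_zero normN) mul0r.
apply: le_trans (norm_dist_triangle (g v) _ _) _.
rewrite -natr1 mulrDl mul1r lerD2r /= -(linear_mapB _ _ ig.1) ig.2.
exact: IH.
Qed.

Lemma midpoint_self v : 2^-1 *: (v + v) = v.
Proof. by rewrite -mulr2n -[v *+ 2]scaler_nat scalerA mulVf ?scale1r ?pnatr_eq0. Qed.

Lemma midway_displacement g v : N (midway g v - v) = N (g v - v) / 2.
Proof.
rewrite -norm_half /midway -{3}[v]midpoint_self -scalerBr.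
by rewrite [v + g v]addrC [v + v]addrC opprD addrACA subrr addr0.
Qed.

Lemma average_displacement g e v : isometric_map g ->
  N (average g e v - v) <= (2 ^ e)%:R * N (g v - v).
Proof.
move=> ig; elim: e => [|e IH]; first
  by rewrite subrr (norm_zero normN) mul1r (norm_ge0 normN).
apply: le_trans (norm_dist_triangle (midway (iter (2 ^ e) g) v) _ _) _.
have ih := midway_nonexpansive (isometric_nonexpansive (isometric_iter (2 ^ e) ig)).
rewrite /= -(linear_mapB _ _ ih.1) midway_displacement expnS natrM.
have := ih.2 (average g e v - v).
have := isometric_iter_displacement (2 ^ e) v ig.
have := norm_ge0 normN (g v - v); have : 0 <= (2 ^ e)%:R :> R by [].
by nra.
Qed.

(** [g - 1] telescopes against the sum of the powers of [g]; this is what makes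
    long averages almost invariant. *)
Lemma average_telescope g e v : isometric_map g ->
  g (average g e v) - average g e v = 2^-1 ^+ e *: (iter (2 ^ e) g v - v).
Proof.
move=> ig; elim: e v => [|e IH] v; first by rewrite scale1r.
have gh := commuting_midway ig.1 (commuting_iter (2 ^ e) (fun=> erefl)).
have [lh _] := midway_nonexpansive (isometric_nonexpansive (isometric_iter (2 ^ e) ig)).
have [li _] := isometric_iter (2 ^ e) ig.
rewrite /= gh -(linear_mapB _ _ lh) IH linear_mapZ// exprSr -scalerA.
congr (_ *: _); rewrite /midway; congr (_ *: _).
rewrite linear_mapB// -iterD addnn -mul2n -expnS.
by rewrite addrC addrA subrK.
Qed.

Lemma iter_average_displacement g p e v : isometric_map g ->
  N (iter p g (average g e v) - average g e v) <= p%:R * 2 * 2^-1 ^+ e * N v.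
Proof.
move=> ig; apply: le_trans (isometric_iter_displacement _ _ ig) _.
rewrite -!mulrA ler_wpM2l// average_telescope//.
rewrite (is_norm_homogeneous normN) ger0_norm ?exprn_ge0 ?invr_ge0//.
rewrite mulrCA ler_wpM2l ?exprn_ge0 ?invr_ge0//.
apply: le_trans (norm_leB _ _) _.
by rewrite (isometric_iter _ ig).2 mulr_natl mulr2n.
Qed.

(** * Heisenberg triples *)

(** The relation [x ^ p * y ^ q = z ^ (+- p * q) * y ^ q * x ^ p] with [z]
    central, in a form that is symmetric in [x] and [y] and insensitive to the
    sign: only the norm of the defect of commutation is recorded. *)
Definition heisenberg x z y :=
  [/\ commuting z x, commuting z y &
    forall p q v, N (iter p x (iter q y v) - iter q y (iter p x v)) =
                  N (iter (p * q) z v - v)].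

Lemma heisenberg_sym x z y : heisenberg x z y -> heisenberg y z x.
Proof.
by case=> zx zy H; split=> // p q v; rewrite (norm_sub normN) H mulnC.
Qed.

(** The defect is compared with [z w - w] because this is the quantity that a
    long average over the powers of [z] makes small. *)
Definition almost_commute z lambda S T :=
  forall w, N (S (T w) - T (S w)) <= lambda * N (z w - w).

Lemma almost_commute_sym z lambda S T :
  almost_commute z lambda S T -> almost_commute z lambda T S.
Proof. by move=> H w; rewrite (norm_sub normN). Qed.

(** The mean of [p * mu] over [p < 2 ^ e] is at most [2 ^ e * mu / 2]. *)
Lemma almost_commute_average z mu g T e : isometric_map z -> isometric_map g ->
  commuting z g -> nonexpansive T -> 0 <= mu ->
  (forall p, almost_commute z (p%:R * mu) (iter p g) T) ->
  almost_commute z (2 ^+ e * mu / 2) (average g e) T.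
Proof.
move=> iz ig zg cT mu0 gT; elim: e => [|e IH] w /=.
  by rewrite subrr (norm_zero normN) !mulr_ge0// ?invr_ge0// (norm_ge0 normN).
set a := average g e; set h := iter (2 ^ e) g.
have ch : nonexpansive (midway h).
  exact/midway_nonexpansive/isometric_nonexpansive/isometric_iter.
have [la na] := average_nonexpansive e ig.
apply: le_trans (norm_dist_triangle (midway h (T (a w))) _ _) _.
have E1 : N (midway h (a (T w)) - midway h (T (a w))) <=
    2 ^+ e * mu / 2 * N (z w - w).
  by rewrite -(linear_mapB _ _ ch.1); exact: le_trans (ch.2 _) (IH w).
have E2 : N (midway h (T (a w)) - T (midway h (a w))) <=
    2 ^+ e * mu / 2 * N (z w - w).
  rewrite /midway (linear_mapZ _ _ cT.1) (linear_mapD _ _ cT.1).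
  rewrite -scalerBr [X in X - _]addrC addrKA norm_half.
  have := gT (2 ^ e)%N (a w); rewrite -/h natrX.
  have : N (z (a w) - a w) <= N (z w - w).
    by rewrite (commuting_average e iz.1 zg) -(linear_mapB _ _ la) na.
  have : 0 <= 2 ^+ e * mu by rewrite mulr_ge0// exprn_ge0.
  by nra.
by rewrite exprS; lra.
Qed.

Lemma heisenberg_almost_commute x z y a b l :
  isometric_map x -> isometric_map z -> isometric_map y -> heisenberg x z y ->
  almost_commute z (2 ^+ (a + b + l) / 4)
    (average x a) (average (iter (2 ^ b) y) l).
Proof.
move=> ix iz iy [zx zy H]; apply/almost_commute_sym.
have xy q : almost_commute z (2 ^+ a * q%:R / 2) (average x a) (iter q y).
  apply: almost_commute_average => //.
    exact/isometric_nonexpansive/isometric_iter.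
  move=> p w; rewrite H -natrM; exact: isometric_iter_displacement.
rewrite (_ : 2 ^+ (a + b + l) / 4 = 2 ^+ l * (2 ^+ (a + b) / 2) / 2); last first.
  by rewrite exprD; move: (2 ^+ (a + b)) (2 ^+ l) => r t; field.
apply: almost_commute_average => //.
- exact: isometric_iter.
- exact: commuting_iter.
- exact: average_nonexpansive.
- by rewrite divr_ge0// exprn_ge0.
- move=> p w; have := almost_commute_sym (xy (p * 2 ^ b)%N) w.
  rewrite natrM natrX exprD; move: (2 ^+ a) (2 ^+ b) => r t.
  rewrite (_ : p%:R * (r * t / 2) = r * (p%:R * t) / 2); last by field.
  by rewrite !iterM.
Qed.

(** * Gain of invariance *)

(** Uniform convexity at the single distance [1 / 12]. The constants are those
    of [commutator_contraction] and [gain_step]: four displacements of [1 / 12]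
    add up to [1 / 3], and [1 - delta >= 8 / 9 = 2 / 3 * (4 / 3)]. *)
Definition convexity_gap (delta : R) :=
  0 < delta <= 9^-1 /\ forall v w, N w = N v ->
  N (w - v) <= N v / 12 \/ N (2^-1 *: (v + w)) <= (1 - delta) * N v.

Section Gain.
Context {delta : R} (gap : convexity_gap delta).

(** If neither average shrinks [b := B (u - c u)], then [g] and [h] almost fix
    [b], hence so does their commutator [c]; since [b + c b = B (u - c (c u))]
    this bounds [b] by about half of [u - c (c u)]. *)
Lemma commutator_contraction g h c S B u :
  isometric_map g -> isometric_map h -> isometric_map c ->
  (forall v, N (g (h v) - h (g v)) = N (c v - v)) ->
  nonexpansive S -> nonexpansive B -> (forall v, B v = S (midway h v)) ->
  commuting B h -> commuting B c ->
  N (midway g (B (u - c u))) <= (1 - delta) * N (u - c u) \/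
  N (midway g (B (u - c u))) <= 2 / 3 * N (u - c (c u)).
Proof.
case: gap => /andP[d0 d9] uc [lg ng] [lh nh] [lc nc] gh cS [lB nB] BE Bh Bc.
set w := u - c u; set b := B w.
have cg : nonexpansive (midway g) by apply: midway_nonexpansive; split=> // v; rewrite ng.
have [hw|hw] := uc w (h w) (nh w); last first.
  left; apply: le_trans (cg.2 _) _; rewrite /b BE; exact: le_trans (cS.2 _) hw.
have hb : N (h b - b) <= N w / 12.
  by rewrite -Bh -(linear_mapB _ _ lB); exact: le_trans (nB _) hw.
have bw : N b <= N w := nB w.
have [gb|gb] := uc b (g b) (ng b); last first.
  by left; apply: le_trans gb _; rewrite ler_wpM2l//; lra.
(* Go from [g (h b)] to [h (g b)] through [g b], [b] and [h b]. *)
have cb : N (c b - b) <= N w / 3.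
  rewrite -gh.
  have := norm_dist_triangle (g b) (g (h b)) (h (g b)).
  have := norm_dist_triangle b (g b) (h (g b)).
  have := norm_dist_triangle (h b) b (h (g b)).
  rewrite -(linear_mapB _ _ lg) ng -(linear_mapB _ _ lh) nh.
  by rewrite (norm_sub normN b (h b)) (norm_sub normN b (g b)); lra.
have E : B (u - c (c u)) = b + c b.
  rewrite /b -Bc -(linear_mapD _ _ lB) /w (linear_mapB _ _ lc).
  by rewrite addrA subrK.
(* [2 b = (b + c b) - (c b - b)]. *)
have b2 : 2 * N b <= N (u - c (c u)) + N w / 3.
  have := norm_leB (b + c b) (c b - b).
  rewrite opprB addrACA subrr addr0 -E.
  have := nB (u - c (c u)); rewrite (_ : N (b + b) = 2 * N b); first by lra.
  by rewrite -mulr2n -scaler_nat (is_norm_homogeneous normN) ger0_norm.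
have [small|large] := leP (N b) ((1 - delta) * N w).
  by left; apply: le_trans (cg.2 _) _.
right; apply: le_trans (cg.2 _) _.
have : 8 / 9 * N w <= N b by have := norm_ge0 normN w; nra.
by lra.
Qed.

Section HeisenbergGain.
Context {x z y : V -> V} (ix : isometric_map x) (iz : isometric_map z).
Context (iy : isometric_map y) (hxyz : heisenberg x z y).

(** One more pair of scales: [x ^ (2 ^ (m - n))] and [y ^ (2 ^ (n + j))] have
    commutator [z ^ (2 ^ (m + j))]. The bound is carried for all small [j]
    because the second alternative of [commutator_contraction] passes from [j]
    to [j.+1]; the weight [(4 / 3) ^ j] compensates its factor [2 / 3]. Blocks of
    [2 * K] scales, of which [y] uses only the lowest [K], separate the new
    scales of [y] from the previous ones of [x], so that these averages commute
    up to an error of order [2 ^- K]. *)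
Lemma gain_step K m a n l D J : (0 < K)%N -> (a + (n + 2 * K) = m.+1)%N ->
  (J < K)%N -> 0 <= D ->
  (forall j u, (j <= J.+1)%N ->
     N (average x a (average (iter (2 ^ (n + 2 * K)) y) l
         (average z m (u - iter (2 ^ (m + j)) z u)))) <=
     D * (4 / 3) ^+ j * N u) ->
  forall j u, (j <= J)%N ->
     N (average x (a + 2 * K) (average (iter (2 ^ n) y) (2 * K + l)
         (average z m (u - iter (2 ^ (m + j)) z u)))) <=
     ((1 - delta) * D + 2 * (1 - delta) ^+ K) * (4 / 3) ^+ j * N u.
Proof.
move=> K0 am JK D0 H j u jJ.
have [zx zy hz] := hxyz; have [/andP[d0 d9] _] := gap.
have ixn k := isometric_iter k ix; have iyn k := isometric_iter k iy.
have izn k := isometric_iter k iz.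
set c := iter _ z; set g := iter (2 ^ (a + (2 * K).-1)) x.
set P := average (iter 1 x) a; set Z := average (iter 1 z) m.
set Q := average (iter (2 ^ (n + 2 * K)) y) l.
set B := average (iter (2 ^ n) y) K.
(* [R1] and [R2] collect the scales of the new blocks that are discarded: [R1]
   is moved to the left end, [R2] onto [u]. *)
pose R1 := average (iter (2 ^ a) x) (2 * K).-1.
pose R2 := average (iter (2 ^ K * 2 ^ n) y) K.
have cP : nonexpansive P by exact: average_nonexpansive.
have cZ : nonexpansive Z by exact: average_nonexpansive.
have cQ : nonexpansive Q by exact: average_nonexpansive.
have cB : nonexpansive B by exact: average_nonexpansive.
have cR1 : nonexpansive R1 by exact: average_nonexpansive.
have cR2 : nonexpansive R2 by exact: average_nonexpansive.
have cg : nonexpansive (midway g).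
  by apply/midway_nonexpansive/isometric_nonexpansive; exact: ixn.
have ccx p k : commuting c (average (iter p x) k).
  exact: commuting_iter_average iz.1 _.
have ccy p k : commuting c (average (iter p y) k).
  exact: commuting_iter_average iz.1 _.
have ccz p k : commuting c (average (iter p z) k).
  exact: commuting_iter_average iz.1 _.
have yy p q d e : commuting (average (iter p y) d) (average (iter q y) e).
  exact: commuting_averages.
have zy' p q d e : commuting (average (iter p z) d) (average (iter q y) e).
  exact: commuting_averages.
have R1g : commuting R1 (midway g).
  exact: (@commuting_averages x x (2 ^ a) (2 ^ (a + (2 * K).-1)) (2 * K).-1 1).
have EX v : average x (a + 2 * K) v = R1 (midway g (P v)).
  rewrite R1g (_ : a + 2 * K = (a + (2 * K).-1).+1)%N; last by lia.
  by rewrite /= average_add.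
have EB v : average (iter (2 ^ n) y) (2 * K) v = B (R2 v).
  rewrite mul2n -addnn average_add.
  rewrite (_ : iter (2 ^ K) (iter (2 ^ n) y) = iter (2 ^ K * 2 ^ n) y).
    exact: (yy (2 ^ K * 2 ^ n) (2 ^ n) K K v)%N.
  by apply/funext => w; rewrite -iterM.
have EY v : average (iter (2 ^ n) y) (2 * K + l) v = B (Q (R2 v)).
  rewrite average_add EB.
  rewrite (_ : iter (2 ^ (2 * K)) (iter (2 ^ n) y) = iter (2 ^ (n + 2 * K)) y).
    exact: (yy (2 ^ (n + 2 * K)) (2 ^ n) l K (R2 v))%N.
  by apply/funext => w; rewrite -iterM -expnD addnC.
set u' := R2 u.
have nu' : N u' <= N u by exact: cR2.2.
pose w := Q (Z (u' - c u')).
have Ew : Q (R2 (average z m (u - c u))) = w.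
  have cc2 : c (R2 u) = R2 (c u) := ccy _ _ u.
  rewrite /w cc2 -(linear_mapB _ _ cR2.1); congr Q.
  exact: (esym (zy' 1 (2 ^ K * 2 ^ n)%N m K (u - c u))).
rewrite EX EY Ew.
have D4 : 0 <= (4 / 3 : R) ^+ j by rewrite exprn_ge0// divr_ge0.
have cI : isometric_map c by exact: izn.
(* The commutation error between the new [y]-scales and the old [x]-scales. *)
have err : N (P (B w) - B (P w)) <= 2 * (1 - delta) ^+ K * N u'.
  have ac := heisenberg_almost_commute a n K ix iz iy hxyz.
  apply: le_trans (ac w) _.
  have zw : N (z w - w) <= 4 * 2^-1 ^+ m * N u'.
    have -> : z w - w = Q (z (Z (u' - c u')) - Z (u' - c u')).
      rewrite (linear_mapB _ _ cQ.1) /w; congr (_ - _).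
      exact: (commuting_iter_average 1 (2 ^ (n + 2 * K)) l iz.1 zy).
    apply: le_trans (cQ.2 _) _.
    apply: le_trans (iter_average_displacement 1 m _ iz) _.
    rewrite mul1r; have := norm_leB u' (c u'); rewrite cI.2 => h2.
    have : 0 <= (2^-1 : R) ^+ m by rewrite exprn_ge0// invr_ge0.
    by nra.
  have half_le : (2^-1 : R) ^+ K <= (1 - delta) ^+ K.
    by rewrite lerXn2r ?nnegrE//; lra.
  have expfV2 : 2 ^+ (a + n + K) * 2^-1 ^+ (a + n + K) = 1 :> R.
    by rewrite -exprMn mulfV ?expr1n// pnatr_eq0.
  have pow : (2 ^+ (a + n + K) / 4) * (4 * 2^-1 ^+ m) = 2 * 2^-1 ^+ K :> R.
    have -> : m = (a + n + K + K.-1)%N by lia.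
    have -> : (2^-1 : R) ^+ K = 2^-1 * 2^-1 ^+ K.-1 by rewrite -exprS prednK.
    rewrite [X in _ * (4 * X)]exprD.
    have := expfV2; move: (2 ^+ _) (2^-1 ^+ _) (2^-1 ^+ _) => p r q pq.
    rewrite (_ : p / 4 * (4 * (q * r)) = p * q * r); last by field.
    by rewrite pq; field.
  have c0 : 0 <= 2 ^+ (a + n + K) / 4 :> R by rewrite divr_ge0 ?exprn_ge0.
  apply: le_trans (ler_wpM2l c0 zw) _.
  by rewrite mulrA pow ler_wpM2r ?(norm_ge0 normN)// ler_wpM2l.
set U := P (Q (Z u')).
have EU k : commuting (iter k z) P -> commuting (iter k z) Q ->
  commuting (iter k z) Z -> P (Q (Z (u' - iter k z u'))) = U - iter k z U.
  move=> kP kQ kZ; rewrite (linear_mapB _ _ cZ.1) (linear_mapB _ _ cQ.1).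
  by rewrite (linear_mapB _ _ cP.1) -kZ -kQ -kP.
have main : N (midway g (B (P w))) <= (1 - delta) * D * (4 / 3) ^+ j * N u'.
  rewrite EU; try exact: ccx || exact: ccy || exact: ccz.
  have jK : (j < K)%N by lia.
  have [S cS ES] := average_split (iyn (2 ^ n)%N) jK.
  have gh v : N (g (iter (2 ^ j) (iter (2 ^ n) y) v) -
                 iter (2 ^ j) (iter (2 ^ n) y) (g v)) = N (c v - v).
    rewrite -!iterM hz /c -!expnD; congr (N (iter (2 ^ _) _ _ - _)); lia.
  have Bh : commuting B (iter (2 ^ j) (iter (2 ^ n) y)).
    apply/commuting_sym; apply: commuting_iter_average (iyn _).1 _.
    by apply/commuting_sym/commuting_iter.
  have [le1|le2] := commutator_contraction U (ixn _) (isometric_iter _ (iyn _))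
    cI gh cS cB ES Bh (commuting_sym (ccy _ _)).
    apply: le_trans le1 _; rewrite -!mulrA ler_wpM2l//; first by lra.
    rewrite mulrA -EU; try exact: ccx || exact: ccy || exact: ccz.
    exact: H (leqW jJ).
  apply: le_trans le2 _.
  have -> : c (c U) = iter (2 ^ (m + j.+1)) z U.
    by rewrite /c -iterD addnn -mul2n -expnS addnS.
  rewrite -EU; try by apply: commuting_iter_average iz.1 _.
  have jJ1 : (j.+1 <= J.+1)%N by [].
  have := H j.+1 u' jJ1.
  have Du : 0 <= D * N u' by rewrite mulr_ge0// (norm_ge0 normN).
  rewrite exprS; move: D4 Du; move: ((4 / 3) ^+ j) => r r0 Du.
  rewrite -/P -/Q -/Z; move: (N (P _)) => p pD.
  have -> : (1 - delta) * D * r * N u' = (1 - delta) * (r * (D * N u')) by ring.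
  have rD : 0 <= r * (D * N u') by rewrite mulr_ge0.
  have : p <= 4 / 3 * (r * (D * N u')).
    by apply: le_trans pD _; rewrite le_eqVlt; apply/orP; left; apply/eqP; ring.
  by nra.
apply: le_trans (cR1.2 _) _.
rewrite -[P (B w)](subrK (B (P w))) (linear_mapD _ _ cg.1).
apply: le_trans (is_norm_triangle normN _ _) _.
apply: le_trans (lerD (le_trans (cg.2 _) err) main) _.
have d1 : 0 <= 1 - delta by lra.
have b0 : 0 <= ((1 - delta) * D + 2 * (1 - delta) ^+ K) * (4 / 3) ^+ j.
  by rewrite mulr_ge0// addr_ge0// mulr_ge0// exprn_ge0.
apply: le_trans (ler_wpM2l b0 nu').
rewrite -mulrDl ler_wpM2r ?(norm_ge0 normN)// [leRHS]mulrDl addrC lerD2l ler_peMr//.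
  by rewrite mulr_ge0// exprn_ge0.
by rewrite exprn_ege1//; lra.
Qed.

Lemma gain_iterated K m a n l i : (0 < K)%N ->
  (a + n = m.+1)%N -> (2 * K * i <= n)%N -> (i <= K)%N ->
  forall j u, (i + j <= K)%N ->
    N (average x (a + 2 * K * i) (average (iter (2 ^ (n - 2 * K * i)) y)
         (2 * K * i + l) (average z m (u - iter (2 ^ (m + j)) z u)))) <=
    2 * ((1 - delta) ^+ i + i%:R * (1 - delta) ^+ K) * (4 / 3) ^+ j * N u.
Proof.
have [/andP[d0 d9] _] := gap.
move=> K0 an; elim: i => [|i IH] ni iK j u ijK.
  rewrite !muln0 !addn0 mul0r addr0 expr0 mulr1.
  have cc := average_nonexpansive.
  apply: le_trans ((cc _ a ix).2 _) _.
  apply: le_trans ((cc _ _ (isometric_iter _ iy)).2 _) _.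
  apply: le_trans ((cc _ m iz).2 _) _.
  apply: le_trans (norm_leB _ _) _.
  rewrite (isometric_iter _ iz).2 -[X in X <= _]mul1r mulrDr -mulrDl.
  have : 1 <= (4 / 3 : R) ^+ j by rewrite exprn_ege1//; lra.
  by have := norm_ge0 normN u; nra.
have E : (n - 2 * K * i = n - 2 * K * i.+1 + 2 * K)%N by nia.
have -> : (a + 2 * K * i.+1 = a + 2 * K * i + 2 * K)%N by nia.
have -> : (2 * K * i.+1 + l = 2 * K + (2 * K * i + l))%N by nia.
have D0 : 0 <= 2 * ((1 - delta) ^+ i + i%:R * (1 - delta) ^+ K).
  by rewrite mulr_ge0// addr_ge0// ?mulr_ge0// exprn_ge0//; lra.
have step := @gain_step K m (a + 2 * K * i) (n - 2 * K * i.+1) (2 * K * i + l)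
  _ (K - i.+1) K0 _ _ D0 _ j u _.
apply: le_trans (step _ _ _ _) _; [nia|lia| |lia|].
  by move=> j' v j'K; rewrite -E; apply: IH; lia.
apply: ler_wpM2r; first exact: norm_ge0 normN _.
apply: ler_wpM2r; first by rewrite exprn_ge0// divr_ge0.
rewrite exprS -natr1.
have : 0 <= i%:R * (1 - delta) ^+ K * delta.
  by rewrite !mulr_ge0 ?exprn_ge0//; lra.
by move: ((1 - delta) ^+ i) ((1 - delta) ^+ K) => p q; lra.
Qed.

(** The scales of [x] rise from [a0] in [K] blocks of length [2 * K], while those
    of [y] descend from [m.+1 - a0]; the hypotheses leave room for this. *)
Lemma gain K m a b u : (0 < K)%N ->
  (2 * K * K <= a)%N -> (2 * K * K <= b)%N ->
  (2 * K * K <= m.+1)%N -> (m.+1 + 2 * K * K <= a + b)%N ->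
  N (average x a (average y b (average z m (u - iter (2 ^ m) z u)))) <=
  2 * K.+1%:R * (1 - delta) ^+ K * N u.
Proof.
move=> K0 aK bK mK mab; have [zx zy _] := hxyz.
pose a0 := (m.+1 - b)%N; pose n := (m.+1 - a0)%N.
have an : (a0 + n = m.+1)%N by rewrite /n /a0; lia.
have nK : (2 * K * K <= n)%N by rewrite /n /a0; lia.
have nb : (n <= b)%N by rewrite /n /a0; lia.
have aa : (a0 + 2 * K * K <= a)%N by rewrite /a0; lia.
have iyn k := isometric_iter k iy; have izn k := isometric_iter k iz.
have main v : N (average x (a0 + 2 * K * K) (average (iter (2 ^ (n - 2 * K * K)) y)
    (2 * K * K + (b - n)) (average z m (v - iter (2 ^ m) z v)))) <=
    2 * K.+1%:R * (1 - delta) ^+ K * N v.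
  have := gain_iterated (b - n) K0 an nK (leqnn K) (j := 0) v.
  rewrite !addn0 expr0 mulr1 -natr1 => /(_ (leqnn _)) h.
  by apply: le_trans h _; rewrite le_eqVlt; apply/orP; left; apply/eqP; ring.
pose T := average (iter 1 y) (n - 2 * K * K).
have cT : nonexpansive T by exact: average_nonexpansive.
rewrite -(subnKC aa) average_add.
apply: le_trans ((average_nonexpansive _ (isometric_iter _ ix)).2 _) _.
have := main (T u).
rewrite (_ : average (iter (2 ^ (n - 2 * K * K)) y) (2 * K * K + (b - n))
    (average z m (T u - iter (2 ^ m) z (T u))) =
  average y b (average z m (u - iter (2 ^ m) z u))).
  move=> h; apply: le_trans h _; rewrite ler_wpM2l ?cT.2//.
  have [/andP[d0 d9] _] := gap.
  by rewrite !mulr_ge0// exprn_ge0//; lra.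
have nKb : (n - 2 * K * K <= b)%N by lia.
rewrite -[in RHS](subnKC nKb) [RHS]average_add; congr average; first by lia.
rewrite (commuting_iter_average _ 1 _ iz.1 zy) -(linear_mapB _ _ cT.1).
exact: (commuting_averages 1 1 _ _ iz iy zy).
Qed.

End HeisenbergGain.

End Gain.

End Contractions.

(** * Words of averages *)

Section Words.
Context {R : realType} {V : lmodType R} {N : V -> R} (normN : is_norm N).
Context {delta : R} (gap : convexity_gap N delta).
Context {x : nat -> V -> V} (ix : forall i, isometric_map N (x i)).
Implicit Types (u v : V) (w : seq (nat * nat)).

(** Products of averages are recorded as words, so that an elementary move can
    be stated once and applied inside any context. *)
Fixpoint word_op w v :=
  if w is (i, e) :: w' then average (x i) e (word_op w' v) else v.

Lemma word_op_cat w1 w2 v : word_op (w1 ++ w2) v = word_op w1 (word_op w2 v).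
Proof. by elim: w1 => //= -[i e] w1 ->. Qed.

Lemma word_op_nonexpansive w : nonexpansive N (word_op w).
Proof.
elim: w => [|[i e] w IH] /=; first by split.
exact: nonexpansive_comp (average_nonexpansive normN e (ix i)) IH.
Qed.

Lemma word_op_displacement w u eps : (forall i, N (x i u - u) <= eps) ->
  N (word_op w u - u) <= (\sum_(p <- w) 2 ^ p.2)%:R * eps.
Proof.
move=> xu; elim: w => [|[i e] w IH].
  by rewrite /= subrr (norm_zero normN) big_nil mul0r.
apply: le_trans (norm_dist_triangle normN (average (x i) e u) _ _) _.
have [la na] := average_nonexpansive normN e (ix i).
rewrite /= -(linear_mapB _ _ la) big_cons natrD mulrDl addrC.
apply: lerD; last exact: le_trans (na _) IH.
apply: le_trans (average_displacement normN _ _ (ix i)) _.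
by rewrite ler_wpM2l.
Qed.

Definition word_close e w1 w2 :=
  forall u, N (word_op w1 u - word_op w2 u) <= e * N u.

Lemma word_close_sym e w1 w2 : word_close e w1 w2 -> word_close e w2 w1.
Proof. by move=> H u; rewrite (norm_sub normN). Qed.

Lemma word_close_step e n w2 w1 w3 : word_close e w1 w2 ->
  word_close (n%:R * e) w2 w3 -> word_close (n.+1%:R * e) w1 w3.
Proof.
move=> H12 H23 u; apply: le_trans (norm_dist_triangle normN (word_op w2 u) _ _) _.
by rewrite -natr1 mulrDl mul1r addrC mulrDl; apply: lerD.
Qed.

Lemma word_close_refl e w : word_close (0%:R * e) w w.
Proof. by move=> u; rewrite subrr (norm_zero normN) !mul0r. Qed.

Lemma word_close_context e p s w1 w2 : 0 <= e -> word_close e w1 w2 ->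
  word_close e (p ++ w1 ++ s) (p ++ w2 ++ s).
Proof.
move=> e0 H u; rewrite !word_op_cat.
have [lp np] := word_op_nonexpansive p.
rewrite -(linear_mapB _ _ lp); apply: le_trans (np _) _.
by apply: le_trans (H _) _; rewrite ler_wpM2l// (word_op_nonexpansive s).2.
Qed.

(** A common bound for all elementary moves at stage [K]: changing a scale by
    one costs [K.+1 * (1 - delta) ^ K], and scales are at most
    [40 * (K * K)]. *)
Definition rate K : R := (40 * (K * K) * K.+1)%:R * (1 - delta) ^+ K.

Lemma rate_ge0 K : 0 <= rate K.
Proof.
have [/andP[d0 d9] _] := gap.
by rewrite mulr_ge0// exprn_ge0//; lra.
Qed.

Lemma le_rate K : (0 < K)%N -> (1 - delta) ^+ K <= rate K.
Proof.
have [/andP[d0 d9] _] := gap.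
move=> K0; rewrite /rate ler_peMl ?exprn_ge0//; first by lra.
by rewrite ler1n; nia.
Qed.

Lemma half_pow_le_rate K e : (0 < K)%N -> (K <= e)%N -> 2^-1 ^+ e <= rate K.
Proof.
have [/andP[d0 d9] _] := gap.
move=> K0 Ke; apply: le_trans (le_rate K0).
apply: (@le_trans _ _ (2^-1 ^+ K)).
  by rewrite ler_wiXn2l// ?invr_ge0// invf_le1 ?ler1n.
by rewrite lerXn2r ?nnegrE//; lra.
Qed.

(** [average z m - average z m.+1] is half of [average z m] composed with
    [1 - z ^ (2 ^ m)], which [gain] bounds. *)
Lemma average_rescale K i j k a b m p u : (0 < K)%N ->
  heisenberg N (x i) (x j) (x k) ->
  (2 * K * K <= a)%N -> (2 * K * K <= b)%N ->
  (2 * K * K <= m.+1)%N -> (m + p + 2 * K * K <= a + b)%N ->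
  N (word_op [:: (i, a); (j, m); (k, b)] u -
     word_op [:: (i, a); (j, m + p)%N; (k, b)] u) <=
  p%:R * (K.+1%:R * (1 - delta) ^+ K) * N u.
Proof.
move=> K0 H aK bK mK; elim: p => [|p IH] mp.
  by rewrite addn0 subrr (norm_zero normN) !mul0r.
have [zx zy _] := H.
set v := word_op [:: (i, a); (j, m + p)%N; (k, b)] u.
apply: le_trans (norm_dist_triangle normN v _ _) _.
rewrite -natr1 mulrDl mulrDl mul1r; apply: lerD; first by apply: IH; lia.
have comm e : average (x j) e (average (x k) b u) =
    average (x k) b (average (x j) e u).
  exact: (commuting_averages normN 1 1 _ _ (ix j) (ix k) zy).
have ca i' e := average_nonexpansive normN e (ix i').
rewrite /v /= addnS comm (comm (m + p).+1) -(linear_mapB _ _ (ca i _).1).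
rewrite -(linear_mapB _ _ (ca k _).1) /=.
set t := average (x j) (m + p) u; set h := iter _ (x j).
have -> : t - midway h t = 2^-1 *: average (x j) (m + p) (u - h u).
  rewrite (linear_mapB _ _ (ca j _).1) -/t.
  rewrite -(commuting_iter_average _ 1 _ (ix j).1 (fun=> erefl)) -/t -/h.
  by rewrite -{1}(midpoint_self t) /midway -scalerBr addrKA.
rewrite (linear_mapZ _ _ (ca k _).1) (linear_mapZ _ _ (ca i _).1).
rewrite (norm_half normN) ler_pdivrMr//.
have := gain normN gap (ix i) (ix j) (ix k) H u K0 aK bK _ _ (m := (m + p)%N).
move=> gn; apply: le_trans (gn _ _) _; [lia|lia|].
by rewrite le_eqVlt; apply/orP; left; apply/eqP; ring.
Qed.

Lemma word_rescale p s K i j k a b m m' : (0 < K)%N ->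
  heisenberg N (x i) (x j) (x k) ->
  (2 * (K * K) <= a)%N -> (2 * (K * K) <= b)%N ->
  (2 * (K * K) <= m)%N -> (2 * (K * K) <= m')%N ->
  (m + 2 * (K * K) <= a + b)%N -> (m' + 2 * (K * K) <= a + b)%N ->
  (m <= 40 * (K * K))%N -> (m' <= 40 * (K * K))%N ->
  word_close (rate K) (p ++ [:: (i, a); (j, m); (k, b)] ++ s)
                      (p ++ [:: (i, a); (j, m'); (k, b)] ++ s).
Proof.
move=> K0 H aK bK; wlog mm' : m m' / (m <= m')%N => [W|] mK mK' mb mb' m4 m4'.
  by have [mm'|/ltnW mm'] := leqP m m'; [|apply: word_close_sym]; apply: W.
apply: word_close_context (rate_ge0 K) _ => u.
have := @average_rescale K i j k a b m (m' - m) u K0 H.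
rewrite subnKC// => W; apply: le_trans (W _ _ _ _) _; try lia.
have [/andP[d0 d9] _] := gap.
rewrite ler_wpM2r ?(norm_ge0 normN)// /rate !natrM mulrA -natrM -natrM.
rewrite ler_wpM2r ?exprn_ge0//; first by lra.
by rewrite -!natrM ler_nat leq_mul2r; apply/orP; right; lia.
Qed.

(** The commutators of the powers of [x i] and [x k] involved are powers of [x j]
    with exponents below [2 ^ (a + b)], and the average over [x j] absorbs
    these. *)
Lemma word_swap p s K i j k a b m : (0 < K)%N ->
  heisenberg N (x i) (x j) (x k) -> (a + b + K <= m)%N ->
  word_close (rate K) (p ++ [:: (i, a); (j, m); (k, b)] ++ s)
                      (p ++ [:: (k, b); (j, m); (i, a)] ++ s).
Proof.
move=> K0 H abm; apply: word_close_context (rate_ge0 K) _ => u /=.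
have [zx zy _] := H.
have cz l e v : commuting (x j) (x l) ->
    average (x j) m (average (x l) e v) = average (x l) e (average (x j) m v).
  move=> zl; exact: (commuting_averages normN 1 1 _ _ (ix j) (ix l) zl).
rewrite !cz//.
have := heisenberg_almost_commute normN a 0 b (ix i) (ix j) (ix k) H.
rewrite addn0 => ac; apply: le_trans (ac _) _.
have h := iter_average_displacement normN 1 m u (ix j).
have c0 : 0 <= 2 ^+ (a + b) / 4 :> R by rewrite divr_ge0 ?exprn_ge0.
apply: le_trans (ler_wpM2l c0 h) _.
rewrite mulrA ler_wpM2r ?(norm_ge0 normN)// mul1r.
apply: le_trans (half_pow_le_rate K0 (leqnn K)).
have -> : m = (a + b + (m - (a + b)))%N by lia.
rewrite [X in _ * (_ * X) <= _]exprD; have : 2 ^+ (a + b) * 2^-1 ^+ (a + b) = 1 :> R.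
  by rewrite -exprMn mulfV ?expr1n// pnatr_eq0.
have : 2^-1 ^+ (m - (a + b)) <= 2^-1 ^+ K :> R.
  rewrite ler_wiXn2l// ?invr_ge0// ?invf_le1 ?ler1n//; lia.
have : 0 <= 2^-1 ^+ (m - (a + b)) :> R by rewrite exprn_ge0// invr_ge0.
move: (2 ^+ _) (2^-1 ^+ (a + b)) (2^-1 ^+ (m - _)) (2^-1 ^+ K) => A B C D C0 CD AB.
have -> : A / 4 * (2 * (B * C)) = A * B * C / 2 by field.
by rewrite AB; lra.
Qed.

End Words.

Arguments word_op {R V} x w v.

(** * The hexagon of root subgroups *)

Definition complete_norm (R : realType) (V : lmodType R) (N : V -> R) :=
  forall t : nat -> V,
  (forall e, 0 < e -> exists n, forall m, (n <= m)%N -> N (t m - t n) <= e) ->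
  exists l, forall e, 0 < e ->
    exists n, forall m, (n <= m)%N -> N (t m - l) <= e.

Section Hexagon.
Context {R : realType} {V : lmodType R} {N : V -> R} (normN : is_norm N).
Context {delta : R} (gap : convexity_gap N delta).
Context {x : nat -> V -> V} (ix : forall i, isometric_map N (x i)).
Context (x6 : forall i, x (i + 6) = x i).
Context (hx : forall i, heisenberg N (x i) (x i.+1) (x i.+2)).
Implicit Types (u v : V) (K : nat).

Notation rate := (@rate R delta).
Notation word_close := (@word_close R V N x).

(** The scale [20 * (K * K)] of the roots [1] and [4] exceeds the sum of those of
    their neighbours, as [word_swap] requires, even when one of these is already
    that of stage [K.+1], provided that [8 <= K]. *)
Definition hexagon_word K : seq (nat * nat) :=
  let d := (8 * (K * K))%N in let b := (20 * (K * K))%N in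
  [:: (0, d); (1, b); (2, d); (3, d); (4, b); (5, d)]%N.

Definition opposite_hexagon_word K : seq (nat * nat) :=
  let d := (8 * (K * K))%N in let b := (20 * (K * K))%N in
  [:: (2, d); (1, b); (0, d); (3, d); (4, b); (5, d)]%N.

Lemma hexagon_word_opposite K : (8 <= K)%N ->
  word_close (rate K) (hexagon_word K) (opposite_hexagon_word K).
Proof.
move=> K8; apply: (@word_swap _ _ _ normN _ gap _ ix [::]
  [:: (3, 8 * (K * K)); (4, 20 * (K * K)); (5, 8 * (K * K))]%N _ 0 1 2) => //.
- by lia.
- by nia.
Qed.

Lemma hexagon_word_grow K : (8 <= K)%N ->
  word_close (13%:R * rate K) (hexagon_word K) (hexagon_word K.+1).
Proof.
move=> K8; have K0 : (0 < K)%N by lia.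
have h405 : heisenberg N (x 4) (x 5) (x 0) by rewrite -(x6 0).
have h501 : heisenberg N (x 5) (x 0) (x 1) by rewrite -(x6 0) -(x6 1).
have sq : (K.+1 * K.+1 = K * K + 2 * K + 1)%N by lia.
have sK : (8 * K <= K * K)%N by nia.
rewrite /hexagon_word; set d := (8 * (K * K))%N; set b := (20 * (K * K))%N.
set d' := (8 * (K.+1 * K.+1))%N; set b' := (20 * (K.+1 * K.+1))%N.
have swap := @word_swap _ _ _ normN _ gap _ ix.
have rescale := @word_rescale _ _ _ normN _ gap _ ix.
(* Reverse both halves: the letters [0] and [5] become adjacent, so that both
   can be raised to the scale [d']. *)
apply: (word_close_step normN (swap [::] [:: (3, d); (4, b); (5, d)]%N
  K _ _ _ _ _ _ K0 (hx 0) _) _); try lia.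
apply: (word_close_step normN (swap [:: (2, d); (1, b); (0, d)]%N [::]
  K _ _ _ _ _ _ K0 (hx 3) _) _); try lia.
apply: (word_close_step normN (rescale [:: (2, d)]%N [:: (4, b); (3, d)]%N
  K _ _ _ _ _ _ d' K0 (heisenberg_sym normN h501) _ _ _ _ _ _ _ _) _); try lia.
apply: (word_close_step normN (rescale [:: (2, d); (1, b)]%N [:: (3, d)]%N
  K _ _ _ _ _ _ d' K0 (heisenberg_sym normN h405) _ _ _ _ _ _ _ _) _); try lia.
apply: (word_close_step normN (swap [::] [:: (5, d'); (4, b); (3, d)]%N
  K _ _ _ _ _ _ K0 (heisenberg_sym normN (hx 0)) _) _); try lia.
apply: (word_close_step normN (swap [:: (0, d'); (1, b); (2, d)]%N [::]
  K _ _ _ _ _ _ K0 (heisenberg_sym normN (hx 3)) _) _); try lia.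
(* In the original order the other four letters stand between their neighbours.
   The scale [b'] of [1] is larger than neighbours of scale [d'] allow, so [2] is
   temporarily raised to [2 * d']; likewise [3] for the sake of [4]. *)
apply: (word_close_step normN (rescale [:: (0, d'); (1, b)]%N [:: (5, d')]%N
  K _ _ _ _ _ _ d' K0 (hx 2) _ _ _ _ _ _ _ _) _); try lia.
apply: (word_close_step normN (rescale [:: (0, d')]%N [:: (4, b); (5, d')]%N
  K _ _ _ _ _ _ (2 * d')%N K0 (hx 1) _ _ _ _ _ _ _ _) _); try lia.
apply: (word_close_step normN (rescale [::] [:: (3, d'); (4, b); (5, d')]%N
  K _ _ _ _ _ _ b' K0 (hx 0) _ _ _ _ _ _ _ _) _); try lia.
apply: (word_close_step normN (rescale [:: (0, d')]%N [:: (4, b); (5, d')]%N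
  K _ _ _ _ _ _ d' K0 (hx 1) _ _ _ _ _ _ _ _) _); try lia.
apply: (word_close_step normN (rescale [:: (0, d'); (1, b')]%N [:: (5, d')]%N
  K _ _ _ _ _ _ (2 * d')%N K0 (hx 2) _ _ _ _ _ _ _ _) _); try lia.
apply: (word_close_step normN (rescale [:: (0, d'); (1, b'); (2, d')]%N [::]
  K _ _ _ _ _ _ b' K0 (hx 3) _ _ _ _ _ _ _ _) _); try lia.
apply: (word_close_step normN (rescale [:: (0, d'); (1, b')]%N [:: (5, d')]%N
  K _ _ _ _ _ _ d' K0 (hx 2) _ _ _ _ _ _ _ _) _); try lia.
exact: word_close_refl.
Qed.

(** The polynomial factor grows by [(K + 1) * (K + 2) / K ^ 2], which is at
    most [(1 - delta / 2) / (1 - delta)] as soon as [delta * K >= 10]. *)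
Lemma rate_succ K : 10 <= delta * K%:R -> rate K.+1 <= (1 - delta / 2) * rate K.
Proof.
have [/andP[d0 d9] _] := gap.
move=> dK; rewrite /rate exprS; have : 0 <= (1 - delta) ^+ K.
  by rewrite exprn_ge0//; lra.
move: ((1 - delta) ^+ K) => p p0; rewrite !mulrA ler_wpM2r//.
rewrite !natrM -[K.+2%:R]natr1 -[K.+1%:R]natr1; have : 0 <= K%:R :> R by [].
have : 1 <= K%:R :> R by case: K dK => [|k _]; [rewrite mulr0; lra|rewrite ler1n].
move: (K%:R : R) dK => k dk k1 k0.
have : (k + 2) * (1 - delta) * (k + 1) <= (1 - delta / 2) * (k * k) by nra.
have k40 : 0 <= 40 * (k + 1) by lra.
by move=> /(ler_wpM2l k40); lra.
Qed.

Lemma rate_small eps : 0 < eps -> exists K0, forall K, (K0 <= K)%N ->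
  [/\ (8 <= K)%N, 10 <= delta * K%:R & rate K <= eps].
Proof.
have [/andP[d0 d9] _] := gap.
move=> e0; pose K1 := maxn 8 (Num.bound (10 / delta)).
have K1P K : (K1 <= K)%N -> (8 <= K)%N /\ 10 <= delta * K%:R.
  rewrite geq_max => /andP[K8 Kd]; split=> //.
  rewrite mulrC -ler_pdivrMr//; apply: ltW.
  apply: lt_le_trans (archi_boundP _) _; first by rewrite divr_ge0// ltW.
  by rewrite ler_nat.
have decay n : rate (K1 + n) <= (1 - delta / 2) ^+ n * rate K1.
  elim: n => [|n IH]; first by rewrite addn0 mul1r.
  rewrite addnS; apply: le_trans (rate_succ (K1P _ (leq_addr _ _)).2) _.
  by rewrite exprS -mulrA ler_wpM2l//; lra.
have l1 : `|1 - delta / 2| < 1 by rewrite ger0_norm; lra.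
have /cvgrPdist_lt /(_ (eps / (rate K1 + 1))) := cvg_expr l1.
have r1 : 0 < rate K1 + 1 by have := rate_ge0 gap K1; lra.
case=> [|n0 _ H]; first by rewrite divr_gt0.
exists (K1 + n0)%N => K KK.
have [K8 dK] := K1P K (leq_trans (leq_addr _ _) KK); split=> //.
have := H (K - K1)%N; rewrite /= => /(_ _) Hn.
have : `|0 - (1 - delta / 2) ^+ (K - K1)| < eps / (rate K1 + 1) by apply: Hn; lia.
rewrite sub0r normrN ger0_norm ?exprn_ge0//; last by lra.
rewrite ltr_pdivlMr// => h.
have := decay (K - K1)%N; rewrite subnKC; last by lia.
have : 0 <= (1 - delta / 2) ^+ (K - K1) by rewrite exprn_ge0//; lra.
by move: ((1 - delta / 2) ^+ _) h => p h; nra.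
Qed.

(** By [rate_succ] the cost [13 * rate K] of one stage is at most
    [26 / delta * (rate K - rate K.+1)], and these bounds telescope. *)
Lemma hexagon_word_cauchy K n : (8 <= K)%N -> 10 <= delta * K%:R ->
  word_close (26 / delta * (rate K - rate (K + n)))
    (hexagon_word K) (hexagon_word (K + n)).
Proof.
have [/andP[d0 d9] _] := gap.
move=> K8 dK; elim: n => [|n IH] u.
  by rewrite addn0 subrr (norm_zero normN) subrr mulr0 mul0r.
apply: le_trans (norm_dist_triangle normN (word_op x (hexagon_word (K + n)) u) _ _) _.
have Kn8 : (8 <= K + n)%N by lia.
have dKn : 10 <= delta * (K + n)%:R.
  by apply: le_trans dK _; rewrite ler_pM2l// ler_nat leq_addr.
rewrite addnS; have h := hexagon_word_grow Kn8 u.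
apply: le_trans (lerD (IH u) h) _; rewrite -mulrDl.
apply: ler_wpM2r; first exact: norm_ge0.
have := rate_succ dKn; move: (rate (K + n)) (rate _.+1) (rate K) => r r' s rr.
have : 13 * r <= 26 / delta * (r - r').
  by rewrite mulrAC ler_pdivlMr//; lra.
by lra.
Qed.

Lemma word_first_displacement i e w u :
  N (x i (word_op x ((i, e) :: w) u) - word_op x ((i, e) :: w) u) <=
  2 * 2^-1 ^+ e * N u.
Proof.
have := iter_average_displacement normN 1 e (word_op x w u) (ix i).
rewrite mul1r => h; apply: le_trans h _; apply: ler_wpM2l.
  by rewrite mulr_ge0// exprn_ge0// invr_ge0.
exact: (word_op_nonexpansive normN ix w).2.
Qed.

(** A word is almost fixed by its first letter; for the letter [2] the word is
    replaced by the nearby [opposite_hexagon_word]. *)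
Lemma hexagon_word_displacement K u : (8 <= K)%N ->
  N (x 0 (word_op x (hexagon_word K) u) - word_op x (hexagon_word K) u) <=
    4 * rate K * N u /\
  N (x 2 (word_op x (hexagon_word K) u) - word_op x (hexagon_word K) u) <=
    4 * rate K * N u.
Proof.
move=> K8; have K0 : (0 < K)%N by lia.
have r0 := rate_ge0 gap K; have u0 := norm_ge0 normN u.
have hp : 2^-1 ^+ (8 * (K * K)) <= rate K by apply: (half_pow_le_rate gap) => //; nia.
have fst_le i w : N (x i (word_op x ((i, 8 * (K * K))%N :: w) u) -
    word_op x ((i, 8 * (K * K))%N :: w) u) <= 2 * rate K * N u.
  apply: le_trans (word_first_displacement _ _ _ _) _.
  by rewrite ler_wpM2r// ler_wpM2l.
split; first by apply: le_trans (fst_le _ _) _; rewrite ler_wpM2r//; lra.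
set t := word_op x (hexagon_word K) u.
set o := word_op x (opposite_hexagon_word K) u.
have to : N (t - o) <= rate K * N u := hexagon_word_opposite K8 u.
have h2 : N (x 2 o - o) <= 2 * rate K * N u := fst_le 2 _.
have := norm_dist_triangle normN (x 2 o) (x 2 t) t.
have := norm_dist_triangle normN o (x 2 o) t.
rewrite -(linear_mapB _ _ (ix 2).1) (ix 2).2 (norm_sub normN o).
by lra.
Qed.

(** The fixed vector is the limit of the hexagon words applied to [u]. The
    word at a late stage [K] is close to the limit uniformly in [u], and it
    involves only finitely many powers of the letters, so it moves [u] little if
    each letter does. *)
Theorem fixed_vector_near : complete_norm N -> forall gamma, 0 < gamma ->
  exists2 eps, 0 < eps & forall u, (forall i, N (x i u - u) <= eps * N u) ->
  exists eta, [/\ x 0 eta = eta, x 2 eta = eta & N (u - eta) <= gamma * N u].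
Proof.
have [/andP[d0 d9] _] := gap.
move=> compN gamma g0.
have c0 : 0 < 26 / delta by rewrite divr_gt0.
have [K KP] : exists K, forall m, (K <= m)%N ->
    [/\ (8 <= m)%N, 10 <= delta * m%:R & 26 / delta * rate m <= gamma / 3].
  have [|K KP] := @rate_small (gamma / 3 / (26 / delta)); first by rewrite !divr_gt0.
  exists K => m /KP[m8 dm rm]; split=> //.
  by rewrite mulrC -ler_pdivlMr.
pose C : R := (\sum_(p <- hexagon_word K) 2 ^ p.2)%:R + 1.
have C0 : 0 < C by rewrite ltr_wpDl.
exists (gamma / (3 * C)); first by rewrite divr_gt0// mulr_gt0.
move=> u xu; have u0 := norm_ge0 normN u.
pose t n := word_op x (hexagon_word n) u.
have tcauchy m n : (K <= m)%N -> (m <= n)%N ->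
    N (t m - t n) <= 26 / delta * rate m * N u.
  move=> Km mn; have [m8 dm _] := KP _ Km.
  have := hexagon_word_cauchy (n - m) m8 dm u; rewrite subnKC// => h.
  apply: le_trans h _; apply: ler_wpM2r => //; apply: ler_wpM2l; first exact: ltW.
  by rewrite gerBl (rate_ge0 gap).
have small e : 0 < e -> exists n, forall m, (n <= m)%N ->
    (K <= m)%N /\ (26 / delta + 4) * rate m * N u <= e.
  move=> e0; have a0 : 0 < (26 / delta + 4) * (N u + 1).
    by apply: mulr_gt0; lra.
  have [|n nP] := @rate_small (e / ((26 / delta + 4) * (N u + 1))).
    by rewrite divr_gt0.
  exists (maxn K n) => m; rewrite geq_max => /andP[Km nm]; split=> //.
  have [_ _] := nP _ nm; rewrite ler_pdivlMr// => h; apply: le_trans h.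
  rewrite mulrAC mulrC; apply: ler_wpM2l; first exact: rate_ge0 gap _.
  by apply: ler_wpM2l; lra.
have [|eta etaP] := compN t.
  move=> e /small[n nP]; exists n => m nm; rewrite (norm_sub normN).
  have [Kn en] := nP n (leqnn n); apply: le_trans (tcauchy n m Kn nm) _.
  apply: le_trans en; have := rate_ge0 gap n.
  have : 0 <= rate n * N u by rewrite mulr_ge0// (rate_ge0 gap).
  by rewrite -!mulrA; move: (rate n * N u) => r; nra.
have fixed i : (forall m, (8 <= m)%N -> N (x i (t m) - t m) <= 4 * rate m * N u) ->
    x i eta = eta.
  move=> ti; apply/subr0_eq/(is_norm_eq0 normN)/le_anti.
  rewrite (norm_ge0 normN) andbT; apply/ler_addgt0Pr => e e0; rewrite add0r.
  have e3 : 0 < e / 3 by rewrite divr_gt0.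
  have [n1 n1P] := etaP _ e3; have [n2 n2P] := small _ e3.
  have [Km em] := n2P _ (leq_maxr n1 n2); have em' := n1P _ (leq_maxl n1 n2).
  set m := maxn n1 n2 in Km em em'; have [m8 _ _] := KP _ Km.
  have tm := ti _ m8.
  have := norm_dist_triangle normN (x i (t m)) (x i eta) eta.
  have := norm_dist_triangle normN (t m) (x i (t m)) eta.
  rewrite -(linear_mapB _ _ (ix i).1) (ix i).2 (norm_sub normN eta).
  have : 0 <= 26 / delta * rate m * N u.
    apply: mulr_ge0 => //; apply: mulr_ge0; first exact: ltW.
    exact: rate_ge0 gap _.
  by lra.
exists eta; split.
- by apply: fixed => m m8; have [] := hexagon_word_displacement u m8.
- by apply: fixed => m m8; have [] := hexagon_word_displacement u m8.
have tK : N (u - t K) <= gamma / 3 * N u.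
  rewrite (norm_sub normN); apply: le_trans (word_op_displacement normN ix _ xu) _.
  rewrite mulrA; apply: ler_wpM2r => //.
  rewrite mulrA ler_pdivrMr ?mulr_gt0//.
  rewrite (_ : gamma / 3 * (3 * C) = gamma * C); last by field.
  by rewrite mulrC ler_wpM2l ?ltW// /C ltrDl.
have tuK m : (K <= m)%N -> N (t K - t m) <= gamma / 3 * N u.
  move=> Km; apply: le_trans (tcauchy _ _ (leqnn K) Km) _.
  by apply: ler_wpM2r => //; have [] := KP _ (leqnn K).
have step e : 0 < e -> N (u - eta) <= 2 * (gamma / 3) * N u + e.
  move=> e0; have [n nP] := etaP _ e0.
  have := nP _ (leq_maxr K n); have := tuK _ (leq_maxl K n).
  have := norm_dist_triangle normN (t K) u eta.
  have := norm_dist_triangle normN (t (maxn K n)) (t K) eta.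
  by lra.
have -> : gamma = 2 * (gamma / 3) + gamma / 3 by field.
apply: (@le_trans _ _ (2 * (gamma / 3) * N u)).
  by apply/ler_addgt0Pr.
by apply: ler_wpM2r => //; lra.
Qed.

End Hexagon.

(** * An invariant uniformly convex norm *)

Section UniformConvexity.
Context {R : realType} {V : lmodType R} {N : V -> R} (normN : is_norm N).
Implicit Types (v w : V).

Lemma norm_scale_pos a v : 0 <= a -> N (a *: v) = a * N v.
Proof. by move=> a0; rewrite (is_norm_homogeneous normN) ger0_norm. Qed.

(** Uniform convexity is stated for unit vectors; vectors of smaller norm are
    either normalised at a small cost, or short enough for the midpoint to be
    short for trivial reasons. *)
Lemma uniformly_convex_ball eps : uniformly_convex N -> 0 < eps <= 2 ->
  exists2 delta, 0 < delta & forall v w r, N v <= r -> N w <= r ->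
  eps * r <= N (v - w) -> N (2^-1 *: (v + w)) <= (1 - delta) * r.
Proof.
move=> [dl [dl01 ucN]] /andP[e0 e2].
have e2' : 0 < eps / 2 <= 2 by apply/andP; split; lra.
have := dl01 _ e2'; set d := dl (eps / 2) => /andP[d0 d1].
pose tau := Num.min (eps / 4) (d / 2).
have t0 : 0 < tau by rewrite lt_min !divr_gt0.
have te : tau <= eps / 4 by rewrite ge_min lexx.
have td : tau <= d / 2 by rewrite ge_min lexx orbT.
exists (tau / 2); first by rewrite divr_gt0.
move=> v w r vr wr; have v0 := norm_ge0 normN v; have w0 := norm_ge0 normN w.
have mid : N (2^-1 *: (v + w)) <= (N v + N w) / 2.
  by rewrite (norm_half normN) ler_wpM2r ?invr_ge0//; exact: is_norm_triangle.
have [r0|rpos] := leP r 0; first by nra.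
have [sv|lv] := leP (N v) ((1 - tau) * r); first by move=> _; nra.
have [sw|lw] := leP (N w) ((1 - tau) * r); first by move=> _; nra.
have v1 : 0 < N v by nra.
have w1 : 0 < N w by nra.
(* Compare [v] and [w] with their multiples of norm [r]. *)
pose v' := (N v)^-1 *: v; pose w' := (N w)^-1 *: w.
have nv' : N v' = 1.
  by rewrite norm_scale_pos ?invr_ge0 ?mulVf// gt_eqF.
have nw' : N w' = 1.
  by rewrite norm_scale_pos ?invr_ge0 ?mulVf// gt_eqF.
have dist t : N t <= r -> (1 - tau) * r < N t -> 0 < N t ->
    N (r *: ((N t)^-1 *: t) - t) <= tau * r.
  move=> tr tl tpos; rewrite -{3}[t]scale1r -(divff (lt0r_neq0 tpos)) -scalerA.
  rewrite -scalerBl norm_scale_pos ?subr_ge0// norm_scale_pos ?invr_ge0 ?ltW//.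
  by rewrite mulVf ?gt_eqF// mulr1; lra.
have dv := dist v vr lv v1; have dw := dist w wr lw w1.
rewrite -/v' in dv; rewrite -/w' in dw.
move=> evw.
have far : eps / 2 <= N (v' - w').
  have : N (v - w) <= N (r *: (v' - w')) + 2 * (tau * r).
    apply: le_trans (norm_dist_triangle normN (r *: v') _ _) _.
    have := norm_dist_triangle normN (r *: w') (r *: v') w.
    rewrite scalerBr (norm_sub normN v); lra.
  rewrite norm_scale_pos ?(ltW rpos)//; nra.
have := ucN _ e2' v' w' nv' nw' far; rewrite -/d => close.
rewrite (norm_half normN) in close; rewrite (norm_half normN).
have : N (v + w) <= r * N (v' + w') + 2 * (tau * r).
  have -> : v + w = r *: (v' + w') - ((r *: v' - v) + (r *: w' - w)).
    by rewrite scalerDr addrACA -opprD opprB [RHS]addrC subrK.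
  apply: le_trans (norm_leB normN _ _) _.
  rewrite norm_scale_pos ?(ltW rpos)// lerD2l.
  by have := is_norm_triangle normN (r *: v' - v) (r *: w' - w); lra.
by nra.
Qed.

End UniformConvexity.

Section InvariantNorm.
Context {R : realType} {V : lmodType R} {G : groupType}.
Context {nrm N1 : V -> R} (normN1 : is_norm N1).
Context (equivN : equivalent_norms nrm N1) (ucN1 : uniformly_convex N1).
Context {rho : G -> V -> V} (irho : forall g, isometric_map nrm (rho g)).
Context (rho1 : forall v, rho 1%g v = v).
Context (rhoM : forall g h v, rho (g * h)%g v = rho g (rho h v)).
Implicit Types (g h : G) (v w : V).

(** Uniform convexity survives the supremum: as [nrm] is invariant, a lower bound
    for [v - w] holds uniformly along the orbit. *)
Definition orbit_norm v := sup [set N1 (rho g v) | g in [set: G]]%classic.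

Lemma orbit_norm_le v r : (forall g, N1 (rho g v) <= r) -> orbit_norm v <= r.
Proof.
move=> H; apply: ge_sup; first by exists (N1 (rho 1%g v)), 1%g.
by move=> _ [g _ <-].
Qed.

Lemma le_orbit_norm v g : N1 (rho g v) <= orbit_norm v.
Proof.
have [c [C [c0 C0 cC]]] := equivN.
apply: ub_le_sup; last by exists g.
by exists (C * nrm v) => _ [h _ <-]; rewrite -((irho h).2 v); apply: (cC _).2.
Qed.

Lemma orbit_norm_isometric g : isometric_map orbit_norm (rho g).
Proof.
split=> [|v]; first exact: (irho g).1.
apply/le_anti/andP; split; apply: orbit_norm_le => h.
  by rewrite -rhoM; exact: le_orbit_norm.
rewrite (_ : h = h * g^-1 * g)%g; last by rewrite -mulgA mulVg mulg1.
by rewrite rhoM; exact: le_orbit_norm.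
Qed.

Lemma orbit_norm_is_norm : is_norm orbit_norm.
Proof.
have scale a v : orbit_norm (a *: v) <= `|a| * orbit_norm v.
  apply: orbit_norm_le => g; rewrite (linear_mapZ _ _ (irho g).1).
  by rewrite (is_norm_homogeneous normN1) ler_wpM2l// le_orbit_norm.
split=> [v w|a v|v v0].
- apply: orbit_norm_le => g; rewrite (linear_mapD _ _ (irho g).1).
  apply: le_trans (is_norm_triangle normN1 _ _) _.
  by apply: lerD; exact: le_orbit_norm.
- apply/le_anti; rewrite scale /=; have [->|a0] := eqVneq a 0.
    rewrite normr0 mul0r; apply: le_trans (le_orbit_norm _ 1%g).
    exact: norm_ge0.
  have := scale a^-1 (a *: v).
  by rewrite scalerA mulVf// scale1r normfV ler_pdivlMl ?normr_gt0.
- apply: (is_norm_eq0 normN1); apply/le_anti; rewrite (norm_ge0 normN1) andbT.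
  by rewrite -v0 -{1}[v]rho1; exact: le_orbit_norm.
Qed.

Lemma orbit_norm_equivalent : equivalent_norms nrm orbit_norm.
Proof.
have [c [C [c0 C0 cC]]] := equivN; exists c, C; split=> // v; split.
  apply: le_trans (cC v).1 _; rewrite -{1}[v]rho1; exact: le_orbit_norm.
apply: orbit_norm_le => g; rewrite -((irho g).2 v); exact: (cC _).2.
Qed.

Lemma orbit_norm_gap : exists delta, convexity_gap orbit_norm delta.
Proof.
have [c [C [c0 C0 cC]]] := equivN.
have [c' [C' [c0' C0' cC']]] := orbit_norm_equivalent.
pose eps := Num.min (c / (12 * C')) 2.
have e0 : 0 < eps <= 2.
  apply/andP; split; last by rewrite ge_min lexx orbT.
  by rewrite lt_min divr_gt0 ?mulr_gt0/=.
have [d d0 dP] := uniformly_convex_ball normN1 ucN1 e0.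
exists (Num.min d 9^-1); split.
  by rewrite lt_min d0 invr_gt0 ltr0n ge_min lexx orbT.
move=> v w wv; have [|far] := leP (orbit_norm (w - v)) (orbit_norm v / 12).
  by left.
right; have v0 := norm_ge0 orbit_norm_is_norm v.
apply: (@le_trans _ _ ((1 - d) * orbit_norm v)); last first.
  by apply: ler_wpM2r => //; rewrite lerD2l lerN2 ge_min lexx.
apply: orbit_norm_le => g.
rewrite (linear_mapZ _ _ (irho g).1) (linear_mapD _ _ (irho g).1).
apply: dP; [exact: le_orbit_norm|by rewrite -wv; exact: le_orbit_norm|].
rewrite (norm_sub normN1) -(linear_mapB _ _ (irho g).1).
apply: le_trans (cC _).1; rewrite (irho g).2.
have := (cC' (w - v)).2 => up.
apply: (@le_trans _ _ (c / (12 * C') * orbit_norm v)).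
  by apply: ler_wpM2r => //; rewrite ge_min lexx.
rewrite -mulrA; apply: ler_wpM2l; first exact: ltW.
rewrite ler_pdivrMl ?mulr_gt0//.
by lra.
Qed.

End InvariantNorm.

Lemma complete_norm_equivalent (R : realType) (V : lmodType R) (N M : V -> R) :
  equivalent_norms N M -> complete_norm N -> complete_norm M.
Proof.
move=> [c [C [c0 C0 cC]]] compN t tM.
have [|l lP] := compN t.
  move=> e e0; have [|n nP] := tM (c * e); first exact: mulr_gt0.
  exists n => m /nP h; rewrite -(ler_pM2l c0); exact: le_trans (cC _).1 h.
exists l => e e0; have [|n nP] := lP (e / C); first exact: divr_gt0.
exists n => m /nP; rewrite ler_pdivlMr// mulrC => h.
exact: le_trans (cC _).2 h.
Qed.

(** * Elementary matrices *)

Section Elementary.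
Implicit Types (i j k : 'I_3) (a b c : int).

Definition elementary_mx i j a : 'M[int]_3 := 1%:M + a *: delta_mx i j.

Lemma elementary_mx_tr i j a : (elementary_mx i j a)^T = elementary_mx j i a.
Proof. by rewrite /elementary_mx linearD /= linearZ /= trmx1 trmx_delta. Qed.

Lemma elementary_mx_det i j a : i != j -> \det (elementary_mx i j a) == 1.
Proof.
wlog ji : i j / (j < i)%N => [W|] ij.
  have [lt|] := ltnP j i; first exact: W.
  rewrite leq_eqVlt => /orP[/eqP/val_inj E|lt]; first by rewrite E eqxx in ij.
  by rewrite -det_tr elementary_mx_tr W// eq_sym.
rewrite det_trig; last first.
  apply/is_trig_mxP => k l kl; rewrite !mxE -val_eqE (ltn_eqF kl) add0r.
  case: (k =P i) => [ki|_] /=; last by rewrite mulr0.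
  case: (l =P j) => [lj|_] /=; last by rewrite mulr0.
  by move: kl; rewrite ki lj ltnNge ltnW.
apply/eqP; apply: big1 => k _; rewrite !mxE eqxx.
case: (k =P i) => [->|_] /=; last by rewrite mulr0 addr0.
by rewrite (negPf ij) mulr0 addr0.
Qed.

(** The default value of [insubd] is met only for [i = j]. *)
Definition elementary i j a : SL3Z := insubd (1%g : SL3Z) (elementary_mx i j a).

Lemma elementaryE i j a : i != j ->
  elementary i j a = elementary_mx i j a :> 'M[int]_3.
Proof. by move=> ij; apply: insubdK; exact: elementary_mx_det. Qed.

Lemma mul_elementary_mx i j k l a b :
  elementary_mx i j a *m elementary_mx k l b =
  1%:M + a *: delta_mx i j + b *: delta_mx k l +
  (a * b) *: (delta_mx i l *+ (j == k)).
Proof.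
rewrite /elementary_mx mulmxDl mul1mx mulmxDr mulmx1 -scalemxAl -scalemxAr.
by rewrite mul_delta_mx_cond scalerA -!addrA; congr (_ + _); rewrite addrCA.
Qed.

Lemma elementaryM i j a b : i != j ->
  (elementary i j a * elementary i j b)%g = elementary i j (a + b).
Proof.
move=> ij; apply: val_inj; rewrite /= !elementaryE// mul_elementary_mx.
by rewrite eq_sym (negPf ij) scaler0 addr0 -addrA -scalerDl.
Qed.

Lemma elementary0 i j : elementary i j 0 = 1%g.
Proof.
apply: val_inj; rewrite /elementary /elementary_mx scale0r addr0.
by apply: insubdK; exact: SL3Z_det1.
Qed.

Lemma elementaryX i j n : i != j -> (elementary i j 1 ^+ n)%g = elementary i j n%:Z.
Proof.
move=> ij; elim: n => [|n IH]; first by rewrite elementary0.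
by rewrite expgSr IH elementaryM// -addn1 PoszD.
Qed.

Lemma elementary_commute i j k l a b : i != j -> k != l -> i != l -> j != k ->
  (elementary i j a * elementary k l b)%g =
  (elementary k l b * elementary i j a)%g.
Proof.
move=> ij kl il jk; apply: val_inj; rewrite /= !elementaryE// !mul_elementary_mx.
by rewrite (negPf jk) (eq_sym l) (negPf il) !scaler0 !addr0 addrAC.
Qed.

Lemma elementary_commutator i j k a b : i != j -> j != k -> i != k ->
  (elementary i j a * elementary j k b)%g =
  (elementary i k (a * b) * (elementary j k b * elementary i j a))%g.
Proof.
move=> ij jk ik; apply: val_inj.
rewrite /= !elementaryE// !mul_elementary_mx (eq_sym k) (negPf ik) scaler0 addr0.
rewrite eqxx -addrA -addrA mulmxDr mulmxDr mulmx1 -!scalemxAr.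
rewrite /elementary_mx !mulmxDl !mul1mx -!scalemxAl !mul_delta_mx_cond.
rewrite (eq_sym k) (negPf jk) (eq_sym k) (negPf ik) !scaler0 !addr0 mulr1n.
rewrite -!addrA; congr (_ + _).
by rewrite addrCA [RHS]addrC -[RHS]addrA.
Qed.

Lemma ord3P (P : 'I_3 -> Prop) :
  P (@Ordinal 3 0 isT) -> P (@Ordinal 3 1 isT) -> P (@Ordinal 3 2 isT) ->
  forall i, P i.
Proof.
move=> P0 P1 P2 [[|[|[|//]]] ip].
- by rewrite (_ : Ordinal ip = @Ordinal 3 0 isT)//; exact: val_inj.
- by rewrite (_ : Ordinal ip = @Ordinal 3 1 isT)//; exact: val_inj.
- by rewrite (_ : Ordinal ip = @Ordinal 3 2 isT)//; exact: val_inj.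
Qed.

Lemma elementary_factorization i j k a b c (g : SL3Z) :
  i != j -> j != k -> i != k ->
  (g : 'M[int]_3) =
    1%:M + a *: delta_mx i j + b *: delta_mx i k + c *: delta_mx j k ->
  g = (elementary j k c * (elementary i k b * elementary i j a))%g.
Proof.
move=> ij jk ik gE; apply: val_inj; rewrite /= gE !elementaryE//.
rewrite mul_elementary_mx (eq_sym k) (negPf ik) scaler0 addr0.
rewrite mulmxDr mulmxDr mulmx1 -!scalemxAr /elementary_mx !mulmxDl !mul1mx.
rewrite -!scalemxAl !mul_delta_mx_cond (eq_sym k) (negPf ik) !scaler0 !addr0 -!addrA.
by congr (_ + _); rewrite addrCA [RHS]addrC -[RHS]addrA.
Qed.

Let i0 := @Ordinal 3 0 isT.
Let i1 := @Ordinal 3 1 isT.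
Let i2 := @Ordinal 3 2 isT.

Lemma UT3Z_factorization (g : SL3Z) : g \in UT3Z -> exists a b c,
  g = (elementary i1 i2 c * (elementary i0 i2 b * elementary i0 i1 a))%g.
Proof.
rewrite inE /= => /lower_unitriangularP[gt gd].
exists (g i0 i1), (g i0 i2), (g i1 i2); apply: elementary_factorization => //.
apply/matrixP => r s; rewrite !mxE.
have d r' : g r' r' = 1 by have := gd r'; rewrite mxE.
have z10 : g i1 i0 = 0 by have := gt i0 i1 isT; rewrite mxE.
have z20 : g i2 i0 = 0 by have := gt i0 i2 isT; rewrite mxE.
have z21 : g i2 i1 = 0 by have := gt i1 i2 isT; rewrite mxE.
elim/ord3P: r; elim/ord3P: s;
  by rewrite /= ?d ?z10 ?z20 ?z21 ?mulr1 ?mulr0 ?addr0 ?add0r.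
Qed.

Lemma LT3Z_factorization (g : SL3Z) : g \in LT3Z -> exists a b c,
  g = (elementary i1 i0 c * (elementary i2 i0 b * elementary i2 i1 a))%g.
Proof.
rewrite inE /= => /lower_unitriangularP[gt gd].
exists (g i2 i1), (g i2 i0), (g i1 i0); apply: elementary_factorization => //.
apply/matrixP => r s; rewrite !mxE.
have z01 : g i0 i1 = 0 := gt i0 i1 isT.
have z02 : g i0 i2 = 0 := gt i0 i2 isT.
have z12 : g i1 i2 = 0 := gt i1 i2 isT.
elim/ord3P: r; elim/ord3P: s;
  by rewrite /= ?gd ?z01 ?z02 ?z12 ?mulr1 ?mulr0 ?addr0 ?add0r.
Qed.

(** The six roots in cyclic order: each is the sum of its two neighbours, the
    first three are those of the upper and the last three those of the lower
    unitriangular group. *)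
Definition root_letter n : SL3Z :=
  let r := nth (i0, i1)
    [:: (i0, i1); (i0, i2); (i1, i2); (i1, i0); (i2, i0); (i2, i1)] (n %% 6) in
  elementary r.1 r.2 1.

Lemma root_letter_periodic n : root_letter (n + 6) = root_letter n.
Proof. by rewrite /root_letter modnDr. Qed.

Section Action.
Context {V : Type} {rho : SL3Z -> V -> V} (rho1 : forall v, rho 1%g v = v).
Context (rhoM : forall g h v, rho (g * h)%g v = rho g (rho h v)).

Lemma rho_iter g n v : iter n (rho g) v = rho (g ^+ n)%g v.
Proof. by elim: n => [|n /= ->]; rewrite ?rho1// expgS rhoM. Qed.

Lemma fixed_elementary i j eta a : i != j ->
  rho (elementary i j 1) eta = eta -> rho (elementary i j a) eta = eta.
Proof.
move=> ij fix1.
have fixn n : rho (elementary i j n%:Z) eta = eta.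
  by rewrite -elementaryX// -rho_iter; elim: n => //= n ->.
case: a => n; first exact: fixn.
rewrite -{1}(fixn n.+1) -rhoM elementaryM// NegzE addNr elementary0; exact: rho1.
Qed.

Lemma fixed_unitriangular i j k eta a b c : i != j -> j != k -> i != k ->
  rho (elementary i j 1) eta = eta -> rho (elementary j k 1) eta = eta ->
  rho (elementary j k c * (elementary i k b * elementary i j a))%g eta = eta.
Proof.
move=> ij jk ik fij fjk.
have fik : rho (elementary i k 1) eta = eta.
  have := congr1 (rho ^~ eta) (elementary_commutator 1 1 ij jk ik).
  by rewrite mulr1 !rhoM fij fjk fij => <-.
rewrite rhoM [rho (_ * _)%g _]rhoM (fixed_elementary a ij fij).
by rewrite (fixed_elementary b ik fik) (fixed_elementary c jk fjk).
Qed.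

End Action.

End Elementary.

Section RootLetters.
Context {R : realType} {V : lmodType R} {N : V -> R}.
Context {rho : SL3Z -> V -> V} (irho : forall g, isometric_map N (rho g)).
Context (rho1 : forall v, rho 1%g v = v).
Context (rhoM : forall g h v, rho (g * h)%g v = rho g (rho h v)).

Lemma elementary_heisenberg i j k : i != j -> j != k -> i != k ->
  heisenberg N (rho (elementary i j 1)) (rho (elementary i k 1))
    (rho (elementary j k 1)).
Proof.
move=> ij jk ik; have ji : j != i by rewrite eq_sym.
have kj : k != j by rewrite eq_sym.
have ki : k != i by rewrite eq_sym.
split=> [v|v|p q v].
- by rewrite -!rhoM elementary_commute.
- by rewrite -!rhoM elementary_commute.
rewrite !(rho_iter rho1 rhoM) -!rhoM !elementaryX// elementary_commutator//.
rewrite -PoszM; set z := elementary i k _; set y := elementary j k _.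
set x := elementary i j _.
have -> : (z * (y * x) = (y * x) * z)%g.
  rewrite mulgA [(z * y)%g]elementary_commute// -!mulgA; congr (_ * _)%g.
  by rewrite [(z * x)%g]elementary_commute.
rewrite (rhoM (y * x)%g) -(linear_mapB _ _ (irho _).1); exact: (irho _).2.
Qed.

Lemma root_letter_heisenberg n : is_norm N ->
  heisenberg N (rho (root_letter n)) (rho (root_letter n.+1))
    (rho (root_letter n.+2)).
Proof.
move=> normN; rewrite /root_letter -(addn2 n) -(addn1 n).
rewrite -(modnDml n 1) -(modnDml n 2).
have H := elementary_heisenberg.
have H' i j k ij jk ik := heisenberg_sym normN (@H i j k ij jk ik).
move: (n %% 6)%N (ltn_pmod n (isT : 0 < 6)%N).
by do 6?[case=> [_|]]; [exact: H|exact: H'|exact: H|exact: H'|exact: H|exact: H'|].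
Qed.

End RootLetters.

(** * Relative property (T) *)

Section RealForm.
Context {R : realType} {V : lmodType R}.
Context {nrm N1 : V -> R} (normN1 : is_norm N1).
Context (equivN : equivalent_norms nrm N1) (ucN1 : uniformly_convex N1).
Context (compl : complete_norm nrm).
Context {rho : SL3Z -> V -> V} (irho : forall g, isometric_map nrm (rho g)).
Context (rho1 : forall v, rho 1%g v = v).
Context (rhoM : forall g h v, rho (g * h)%g v = rho g (rho h v)).

Lemma letter_fixed_vector_near s gamma : 0 < gamma ->
  exists2 eps, 0 < eps & forall v,
  (forall n, nrm (rho (root_letter n) v - v) <= eps * nrm v) ->
  exists eta, [/\ rho (root_letter s) eta = eta,
    rho (root_letter s.+2) eta = eta & nrm (v - eta) <= gamma * nrm v].
Proof.
move=> g0; pose N := orbit_norm (N1 := N1) (rho := rho).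
have normN : is_norm N by exact: (orbit_norm_is_norm normN1 equivN irho rho1).
have eqN : equivalent_norms nrm N by exact: (orbit_norm_equivalent equivN irho rho1).
have [delta gap] := orbit_norm_gap normN1 equivN ucN1 irho rho1.
have iN g : isometric_map N (rho g) by exact: (orbit_norm_isometric equivN irho rhoM).
have compN := complete_norm_equivalent eqN compl.
have [c [C [c0 C0 cC]]] := eqN.
pose x n := rho (root_letter (n + s)).
have x6 i : x (i + 6) = x i by rewrite /x addnAC root_letter_periodic.
have hx i : heisenberg N (x i) (x i.+1) (x i.+2).
  by rewrite /x !addSn; exact: root_letter_heisenberg.
have cg : 0 < gamma * c / C by rewrite !mulr_gt0 ?invr_gt0.
have [e e0 H] := fixed_vector_near normN gap (fun i => iN _) x6 hx compN cg.
exists (e * c / C); first by rewrite !mulr_gt0 ?invr_gt0.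
move=> v vx; have [i|eta [f0 f2 near]] := H v.
  apply: le_trans (cC _).2 _; apply: le_trans (_ : C * (e * c / C * nrm v) <= _).
    by apply: ler_wpM2l; [exact: ltW|exact: vx].
  rewrite (_ : C * _ = e * (c * nrm v)); last by field; rewrite gt_eqF.
  by apply: ler_wpM2l; [exact: ltW|exact: (cC v).1].
exists eta; split=> //.
rewrite -(ler_pM2l c0); apply: le_trans (cC _).1 _; apply: le_trans near _.
apply: le_trans (_ : gamma * c / C * (C * nrm v) <= _).
  by apply: ler_wpM2l; [exact: ltW|exact: (cC v).2].
by rewrite le_eqVlt; apply/orP; left; apply/eqP; field; rewrite gt_eqF.
Qed.

End RealForm.

(** The letters [s] and [s.+2] generate a group containing [H]; only the
    consequence for fixed points of actions is recorded. *)
Definition fixed_by_letters s (H : {pred SL3Z}) :=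
  forall (V : Type) (rho : SL3Z -> V -> V), (forall v, rho 1%g v = v) ->
  (forall g h v, rho (g * h)%g v = rho g (rho h v)) ->
  forall eta, rho (root_letter s) eta = eta -> rho (root_letter s.+2) eta = eta ->
  forall h, h \in H -> rho h eta = eta.

Lemma UT3Z_fixed_by_letters : fixed_by_letters 0 UT3Z.
Proof.
move=> V rho rho1 rhoM eta f0 f2 h /UT3Z_factorization[a [b [c ->]]].
exact: (fixed_unitriangular rho1 rhoM).
Qed.

Lemma LT3Z_fixed_by_letters : fixed_by_letters 3 LT3Z.
Proof.
move=> V rho rho1 rhoM eta f0 f2 h /LT3Z_factorization[a [b [c ->]]].
exact: (fixed_unitriangular rho1 rhoM).
Qed.

Section Criterion.
Context {K : numFieldType} {E : completeNormedModType K}.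
Implicit Types (pi : {multiplicative SL3Z -> linear_isometry E}).

Lemma representation1 pi v : pi 1%g v = v.
Proof.
apply: (@isometry_inj _ _ (pi 1%g)).
by rewrite -[LHS]/((pi 1%g * pi 1%g)%g v) -gmulfM mulg1.
Qed.

Lemma representationM pi g h v : pi (g * h)%g v = pi g (pi h v).
Proof. by rewrite gmulfM. Qed.

Lemma real_family_max n (f : nat -> K) : (forall i, f i \is Num.real) ->
  exists2 m, (m <= n)%N & forall i, (i <= n)%N -> f i <= f m.
Proof.
move=> fr; elim: n => [|n [m mn mP]].
  by exists 0%N => // i; rewrite leqn0 => /eqP ->.
have [le|lt] := real_leP (fr m) (fr n.+1).
  exists n.+1 => // i; rewrite leq_eqVlt => /orP[/eqP -> //|/mP im].
  exact: le_trans im le.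
exists m; first exact: leqW.
by move=> i; rewrite leq_eqVlt => /orP[/eqP ->|/mP//]; exact: ltW.
Qed.

Lemma relative_property_T_letters (H : groupClosed SL3Z) :
  (forall pi gamma, 0 < gamma -> exists2 eps, 0 < eps & forall xi : E,
    `|xi| = 1 -> (forall n, `|pi (root_letter n) xi - xi| <= eps) ->
    exists2 eta, fixed_vectors pi H eta & `|xi - eta| < gamma) ->
  relative_property_T E SL3Z H.
Proof.
move=> P pi _ gamma g0; have [eps e0 epsP] := P pi _ g0.
exists [set root_letter n | n in `I_6]%classic, eps; split=> //.
  by apply/finite_compact/finite_image/finite_II.
move=> xi xi1 sup_lt; apply: epsP => // n.
set S := (X in supremum _ X) in sup_lt.
pose f i := `|pi (root_letter i) xi - xi|.
have [m m5 mP] := @real_family_max 5 f (fun i => normr_real _).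
have Sm : S (f m) by exists (root_letter m) => //; exists m.
(* The order of [K] may be partial, as for complex scalars, but a finite set of
   reals has a maximum, which is its supremum. *)
have supm : supremums S (f m).
  split=> [_ [_ [i i6 <-] <-]|b]; [exact: mP|exact].
have nS : f (n %% 6)%N <= supremum 0 S.
  rewrite /supremum; case: ifPn => [/eqP S0|_]; first by rewrite S0 in Sm.
  case: xgetP => [y _ [yub _]|/(_ (f m))//]; apply: yub.
  exists (root_letter (n %% 6)) => //; exists (n %% 6)%N => //=.
  exact: ltn_pmod.
apply: le_trans (ltW sup_lt); apply: le_trans nS.
by rewrite /f /root_letter modn_mod.
Qed.

Lemma cauchy_sequence_limit (t : nat -> E) :
  (forall e : K, 0 < e -> exists n, forall m, (n <= m)%N -> `|t m - t n| <= e) ->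
  exists l, forall e : K, 0 < e ->
    exists n, forall m, (n <= m)%N -> `|t m - l| <= e.
Proof.
move=> tc; have /cauchy_cvgP/cvg_ex[l tl] : (cauchy (t @ \oo))%classic.
  apply/cauchyP => e e0; have [|n nP] := tc (e / 2); first by rewrite divr_gt0.
  exists (t n); exists n => // m /= nm; rewrite -ball_normE /=.
  rewrite distrC; apply: le_lt_trans (nP m nm) _.
  by rewrite gtr_pMr// invf_lt1// ltr1n.
exists l => e e0; have /cvgrPdist_lt/(_ _ e0)[n _ nP] := tl.
by exists n => m nm; rewrite distrC ltW//; exact: nP.
Qed.

End Criterion.

Lemma norm_is_norm (K : numFieldType) (E : normedModType K) :
  is_norm (fun v : E => `|v|).
Proof.
split=> [v w|a v|v]; [exact: ler_normD|exact: normrZ|exact: normr0_eq0].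
Qed.

Lemma relative_property_T_real (R : realType) (E : completeNormedModType R)
    s (H : groupClosed SL3Z) : fixed_by_letters s H -> super_reflexive E ->
  relative_property_T E SL3Z H.
Proof.
move=> Hs [N1 [normN1 equivN ucN1]]; apply: relative_property_T_letters => pi gamma g0.
have irho g : isometric_map (fun v : E => `|v|) (pi g).
  by split=> [|v]; [exact: isometry_linear|exact: isometry_norm].
have g2 : 0 < gamma / 2 by rewrite divr_gt0.
have [eps e0 epsP] := letter_fixed_vector_near normN1 equivN ucN1
  (@cauchy_sequence_limit _ _) irho (representation1 pi) (representationM pi) s g2.
exists eps => // xi xi1 xie; have [|eta [f0 f2 near]] := epsP xi.
  by move=> n; rewrite xi1 mulr1.
exists eta.
  move=> h; exact: (Hs _ (fun g v => pi g v) (representation1 pi)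
    (representationM pi) _ f0 f2 h).
by apply: le_lt_trans near _; rewrite xi1 mulr1 gtr_pMr// invf_lt1// ltr1n.
Qed.

(** * Complex scalars *)

Section Realification.
Context {R : realType}.

(** A copy of [E] that carries the structure of a real module. *)
Definition realification (E : lmodType R[i]) : Type := E.

Context (E : lmodType R[i]).

HB.instance Definition _ := GRing.Zmodule.on (realification E).

Definition realification_scale (r : R) (v : realification E) : realification E :=
  (r%:C)%C *: (v : E).

Lemma realification_scaleA a b v :
  realification_scale a (realification_scale b v) = realification_scale (a * b) v.
Proof. by rewrite /realification_scale scalerA -rmorphM. Qed.

Lemma realification_scale1 : left_id 1 realification_scale.
Proof. by move=> v; rewrite /realification_scale scale1r. Qed.

Lemma realification_scaleDr : right_distributive realification_scale +%R.
Proof. by move=> r v w; rewrite /realification_scale scalerDr. Qed.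

Lemma realification_scaleDl v :
  {morph realification_scale^~ v : a b / a + b}.
Proof. by move=> a b; rewrite /realification_scale rmorphD scalerDl. Qed.

HB.instance Definition _ := GRing.Zmodule_isLmodule.Build R (realification E)
  realification_scaleA realification_scale1 realification_scaleDr
  realification_scaleDl.

Lemma ge0_complex (z : R[i]) : 0 <= z -> z = ((complex.Re z)%:C)%C.
Proof. by rewrite lecE => /andP[/eqP]; case: z => a b /= -> _. Qed.

Context {N : E -> R[i]} (normN : is_norm N).

Definition real_norm (v : realification E) : R := complex.Re (N v).

Lemma real_normE v : N v = ((real_norm v)%:C)%C.
Proof. exact/ge0_complex/norm_ge0. Qed.

Lemma real_norm_is_norm : is_norm real_norm.
Proof.
split=> [v w|a v|v v0].
- by rewrite -lecR rmorphD /= -!real_normE; exact: is_norm_triangle.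
- have := is_norm_homogeneous normN (a%:C)%C v; rewrite !real_normE normc_def /=.
  rewrite expr0n /= addr0 sqrtr_sqr -rmorphM => /complexI; exact.
- by apply: (is_norm_eq0 normN); rewrite real_normE v0.
Qed.

Lemma real_norm_uniformly_convex : uniformly_convex N -> uniformly_convex real_norm.
Proof.
move=> [dl [dl01 H]]; exists (fun e => complex.Re (dl (e%:C)%C)).
have two : 2 = (2%:C)%C :> R[i] by rewrite rmorph_nat.
have dlC e : 0 < e <= 2 -> 0 < dl (e%:C)%C <= 1.
  by move=> e02; apply: dl01; rewrite two ltcR lecR.
have real e : 0 < e <= 2 -> dl (e%:C)%C = ((complex.Re (dl (e%:C)%C))%:C)%C.
  by move=> /dlC/andP[dl0 _]; apply/ge0_complex/ltW.
split=> [e e02|e e02 v w v1 w1 far].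
  by have := dlC _ e02; rewrite (real _ e02) ltcR lecR.
have := H (e%:C)%C; rewrite two ltcR lecR e02 => /(_ isT v w).
rewrite !real_normE v1 w1 lecR => /(_ erefl erefl far).
have -> : (2^-1 *: (v + w) : realification E) = (2%:C)%C^-1 *: (v + w : E).
  by rewrite -fmorphV.
by rewrite -lecR rmorphB rmorph1 /= -(real _ e02).
Qed.

End Realification.

Lemma real_norm_equivalent (R : realType) (E : lmodType R[i]) (N M : E -> R[i]) :
  is_norm N -> is_norm M -> equivalent_norms N M ->
  equivalent_norms (real_norm (N := N)) (real_norm (N := M)).
Proof.
move=> normN normM [c [C [c0 C0 cC]]].
have cE := ge0_complex (ltW c0); have CE := ge0_complex (ltW C0).
exists (complex.Re c), (complex.Re C); split.
- by rewrite -ltcR -cE.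
- by rewrite -ltcR -CE.
- move=> v; have := cC v; rewrite {1}cE {1}CE !(real_normE normN) !(real_normE normM).
  by rewrite -!rmorphM !lecR.
Qed.

Lemma relative_property_T_complex (R : realType) (E : completeNormedModType R[i])
    s (H : groupClosed SL3Z) : fixed_by_letters s H -> super_reflexive E ->
  relative_property_T E SL3Z H.
Proof.
move=> Hs [N1 [normN1 equivN ucN1]]; apply: relative_property_T_letters => pi gamma g0.
have normE := norm_is_norm E; pose nrm := real_norm (N := fun v : E => `|v|).
have nrmE (v : E) : `|v| = ((nrm v)%:C)%C by exact: real_normE normE v.
have irho g : isometric_map nrm (pi g : realification E -> realification E).
  split=> [a v w|v]; first exact: isometry_linear.
  by rewrite /nrm /real_norm isometry_norm.
have compl : complete_norm nrm.
  move=> t tc; have [|l lP] := @cauchy_sequence_limit _ E t.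
    move=> e e0; have eE := ge0_complex (ltW e0).
    have [|n nP] := tc (complex.Re e); first by rewrite -ltcR -eE.
    by exists n => m /nP; rewrite -lecR -eE -nrmE.
  exists l => e e0; have [|n nP] := lP (e%:C)%C; first by rewrite ltcR.
  by exists n => m /nP; rewrite nrmE lecR.
have gE := ge0_complex (ltW g0).
have g2 : 0 < complex.Re gamma / 2 by rewrite divr_gt0// -ltcR -gE.
have [eps e0 epsP] := letter_fixed_vector_near (real_norm_is_norm normN1)
  (real_norm_equivalent normE normN1 equivN)
  (real_norm_uniformly_convex normN1 ucN1) compl irho
  (representation1 pi) (representationM pi) s g2.
exists (eps%:C)%C; first by rewrite ltcR.
move=> xi xi1 xie.
have n1 : nrm xi = 1 by apply/complexI; rewrite -nrmE.
have [|eta [f0 f2 near]] := epsP xi.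
  move=> n; have h : nrm (pi (root_letter n) xi - xi) <= eps * nrm xi.
    by rewrite n1 mulr1 -lecR -nrmE; exact: xie.
  exact: h.
exists eta.
  move=> h; exact: (Hs _ (fun g v => pi g v) (representation1 pi)
    (representationM pi) _ f0 f2 h).
rewrite nrmE gE ltcR; apply: (@le_lt_trans _ _ (complex.Re gamma / 2 * nrm xi)).
  exact: near.
rewrite n1 mulr1 gtr_pMr ?invf_lt1 ?ltr1n//.
by rewrite -ltcR -gE.
Qed.

Theorem theorem1p11 (R : realType) :
  (forall E : completeNormedModType R, super_reflexive E ->
     relative_property_T E SL3Z UT3Z /\ relative_property_T E SL3Z LT3Z) /\
  (forall E : completeNormedModType R[i], super_reflexive E ->
     relative_property_T E SL3Z UT3Z /\ relative_property_T E SL3Z LT3Z).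
Proof.
split=> E srE; split.
- exact: relative_property_T_real UT3Z_fixed_by_letters srE.
- exact: relative_property_T_real LT3Z_fixed_by_letters srE.
- exact: relative_property_T_complex UT3Z_fixed_by_letters srE.
- exact: relative_property_T_complex LT3Z_fixed_by_letters srE.
Qed.
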